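(* Let $\widetilde{\mathcal T}$ be the solution of the constrained least squares problem $$\min_{\mathcal W=\mathcal D\times_{j=1}^mW_j}\ h_n(\mathcal W)=\frac{d^*}{n}\sum_{i=1}^n\big(Y_i-\langle\mathcal W,\mathcal X_i\rangle\big)^2\quad\text{s.t. }W_j\in\mathbb O^{d_j\times r_j},\ \mathrm{Inco}(W_j)\le\mu\ (j\in[m]),\ \mathcal D\in\mathbb R^{r_1\times\cdots\times r_m},$$ where the true tensor satisfies $\|U_j\|_{2,\infty}\le\sqrt{\mu r_j/d_j}$ for all $j\in[m]$ with the same $\mu$. If $n\ge C_{\mathrm{gap}}\mu^mm^2\,\overline r\,r^*\,\overline d\log\overline d$ for a large enough numerical constant $C_{\mathrm{gap}}>0$, then there exists a numerical constant $C>0$ such that $$\|\widetilde{\mathcal T}-\mathcal T\|_F\le C(\sigma\vee\|\mathcal T\|_{\ell_\infty})\sqrt{\frac{\mu^{2m}m^2\,\overline r\,(r^* )^2d^*\,\overline d\log\overline d}{n}}$$ with probability at least $1-6\overline d^{-3m}$.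
   Context: Notation. For dimensions $d_1,\dots,d_m$ and ranks $\mathbf r=(r_1,\dots,r_m)$: $d^*=\prod_jd_j$, $\overline d=\max_jd_j$, $r^*=\prod_jr_j$, $r_{-j}=r^*/r_j$, $\overline r=\max_jr_j$, $a\vee b=\max(a,b)$. $\times_j$ is the mode-$j$ product, $\mathcal D\times_{j=1}^mW_j=\mathcal D\times_1W_1\cdots\times_mW_m$. $\mathbb O^{d\times r}$: $d\times r$ matrices with orthonormal columns; $\|A\|_{2,\infty}$ the largest Euclidean norm of a row; for $W\in\mathbb O^{d\times r}$, $\mathrm{Inco}(W)=d\|W\|_{2,\infty}^2/r$. $\langle\cdot,\cdot\rangle$, $\|\cdot\|_F$, $\|\cdot\|_{\ell_\infty}$ are the entrywise inner product and entrywise $\ell_2,\ell_\infty$ norms of tensors. Model. $\mathcal T\in\mathbb R^{d_1\times\cdots\times d_m}$ has multilinear rank $\mathbf r$, $\mathcal T=\mathcal C\times_{j=1}^mU_j$ with $\mathcal C\in\mathbb R^{r_1\times\cdots\times r_m}$, $U_j\in\mathbb O^{d_j\times r_j}$. One observes $n$ i.i.d. pairs $(\mathcal X_i,Y_i)$, $Y_i=\langle\mathcal T,\mathcal X_i\rangle+\xi_i$, with $\mathcal X_i$ uniform over the $d^*$ canonical basis tensors and $\xi_i$ i.i.d. noise independent of the $\mathcal X_i$, $\mathbb E\xi_i=0$, $\mathbb E\xi_i^2=\sigma^2$, $\mathbb E\exp(c\,\xi_i^2/\sigma^2)\le2$ for some constant $c>0$. Standing assumptions: $n\le\overline d^{4m}$,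 $m\ll\overline d$, $r_{-j}\lesssim d_j$ for all $j$. *)

(* Defs.v *)
From HB Require Import structures.
From mathcomp Require Import all_boot all_order all_algebra.
From mathcomp Require Import all_classical all_reals all_analysis.

Set Implicit Arguments.
Unset Strict Implicit.
Unset Printing Implicit Defensive.

Import Order.TTheory GRing.Theory Num.Theory.
Import numFieldNormedType.Exports.

Local Open Scope classical_set_scope.
Local Open Scope ring_scope.

(* The order [m] tensors of shape d_1 x ... x d_m are the real-valued
   functions of a multi-index (i_1, ..., i_m), i_j < d_j. *)
Definition multi_index (m : nat) (d : 'I_m -> nat) :=
  {dffun forall j : 'I_m, 'I_(d j)}.

Definition tensor (R : realType) (m : nat) (d : 'I_m -> nat) :=
  {ffun multi_index d -> R}.

Definition dim_prod (m : nat) (d : 'I_m -> nat) : nat := (\prod_j d j)%N.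
Definition dim_max (m : nat) (d : 'I_m -> nat) : nat := (\max_j d j)%N.

Section Tensors.
Variables (R : realType) (m : nat).
Implicit Types d r : 'I_m -> nat.

Definition basis_tensor d (k : multi_index d) : tensor R d :=
  [ffun l => (l == k)%:R].

Definition tensor_dot d (S T : tensor R d) : R := \sum_k S k * T k.

Definition frobenius d (T : tensor R d) : R := Num.sqrt (\sum_k T k ^+ 2).

Definition linf_norm d (T : tensor R d) : R := \big[Num.max/0]_k `|T k|.

(* D x_1 W_1 x_2 ... x_m W_m, entrywise: the iterated mode products contract
   the j-th index of D against the columns of W_j, for every j. *)
Definition multilinear_prod d r (D : tensor R r)
    (W : forall j, 'M[R]_(d j, r j)) : tensor R d :=
  [ffun i : multi_index d =>
     \sum_(k : multi_index r) D k * \prod_j W j (i j) (k j)].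

Definition other_index d (j : 'I_m) :=
  {dffun forall k : {k : 'I_m | k != j}, 'I_(d (sval k))}.

(* The multi-index with [a] in position [j] and [b] in the others. *)
Definition insert_index d (j : 'I_m) (a : 'I_(d j)) (b : other_index d j) :
    multi_index d :=
  [ffun k : 'I_m =>
     match eqVneq k j with
     | EqNotNeq e => ecast k' 'I_(d k') (esym e) a
     | NeqNotEq ne => b (exist _ k ne)
     end].

Definition unfolding d (T : tensor R d) (j : 'I_m) :
    'M[R]_(d j, #|{: other_index d j}|) :=
  \matrix_(a, b) T (insert_index a (enum_val b)).

Definition has_multilinear_rank d (T : tensor R d) r : Prop :=
  forall j, \rank (unfolding T j) = r j.

End Tensors.

Section Incoherence.
Variable R : realType.

Definition orthonormal_cols (p q : nat) (W : 'M[R]_(p, q)) : Prop :=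
  W^T *m W = 1%:M.

Definition norm2inf (p q : nat) (W : 'M[R]_(p, q)) : R :=
  \big[Num.max/0]_(i < p) Num.sqrt (\sum_(l < q) W i l ^+ 2).

Definition Inco (p q : nat) (W : 'M[R]_(p, q)) : R :=
  p%:R * norm2inf W ^+ 2 / q%:R.

End Incoherence.

Section LeastSquares.
Variables (R : realType) (m : nat) (d r : 'I_m -> nat) (mu : R) (n : nat).

Definition feasible (Z : tensor R d) : Prop :=
  exists (D : tensor R r) (W : forall j, 'M[R]_(d j, r j)),
    Z = multilinear_prod D W /\
    forall j, orthonormal_cols (W j) /\ Inco (W j) <= mu.

Definition empirical_loss (X : 'I_n -> tensor R d) (Y : 'I_n -> R)
    (Z : tensor R d) : R :=
  (dim_prod d)%:R / n%:R * \sum_(i < n) (Y i - tensor_dot Z (X i)) ^+ 2.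

Definition is_constrained_lsq (X : 'I_n -> tensor R d) (Y : 'I_n -> R)
    (Z : tensor R d) : Prop :=
  feasible Z /\
  forall Z', feasible Z' -> empirical_loss X Y Z <= empirical_loss X Y Z'.

End LeastSquares.

Section Randomness.
Context {disp : measure_display} {Omega : measurableType disp} {R : realType}.
Variable P : probability Omega R.

Definition sigma_real (f : Omega -> R) : set (set Omega) :=
  preimage_set_system setT f measurable.

(* The sigma-algebra generated by all the entries of a random tensor. *)
Definition sigma_tensor (m : nat) (d : 'I_m -> nat) (X : Omega -> tensor R d) :
    set (set Omega) :=
  <<s [set A | exists k, sigma_real (fun w => X w k) A] >>.

Definition mutually_independent (I : finType) (F : I -> set (set Omega)) :
    Prop :=
  forall (J : {set I}) (E : I -> set Omega),
    (forall i, i \in J -> F i (E i)) ->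
    P (\bigcap_(i in [set` J]) E i) = (\prod_(i in J) P (E i))%E.

Definition identically_distributed (n : nat) (f : 'I_n -> Omega -> R) : Prop :=
  forall (i j : 'I_n) (B : set R), measurable B ->
    P (f i @^-1` B) = P (f j @^-1` B).

Definition random_tensor (m : nat) (d : 'I_m -> nat) (X : Omega -> tensor R d) :
    Prop :=
  forall k, measurable_fun setT (fun w => X w k).

Definition uniform_on_basis (m : nat) (d : 'I_m -> nat)
    (X : Omega -> tensor R d) : Prop :=
  forall k : multi_index d,
    P [set w | X w = basis_tensor R k] = ((dim_prod d)%:R^-1)%:E.

(* The family (X_1, ..., X_n, xi_1, ..., xi_n) is mutually independent: the
   designs are independent, so are the noises, and the noises are independent
   of the designs. *)
Definition design_noise_independent (m n : nat) (d : 'I_m -> nat)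
    (X : 'I_n -> Omega -> tensor R d) (xi : 'I_n -> Omega -> R) : Prop :=
  mutually_independent (fun s : 'I_n + 'I_n =>
    match s with
    | inl i => sigma_tensor (X i)
    | inr i => sigma_real (xi i)
    end).

End Randomness.

(* Main.v *)
(* Write D = Z - T for the difference of the least squares solution Z and the
   truth T, and Q(D) = sum_i (<D, X_i>^2 - 2 xi_i <D, X_i>); minimality of Z
   says Q(D) <= 0.  For a fixed tensor D and
   1 / lam = 16 sigma^2 / c + |D|_inf^2, sub-Gaussianity of the noise gives
   E exp(- lam Q(D)) <= exp(- lam n |D|_F^2 / (4 d^* )), so that one Chernoff
   bound controls the quadratic and the noise part of Q simultaneously:
   n |D|_F^2 / (4 d^* ) <= Q(D) + t / lam with probability 1 - exp(- t).
   A union bound makes this uniform over a grid of the parameters (core,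
   factors, weight of T); rounding to the grid is harmless because the entries
   of a low rank tensor are Lipschitz in its parameters.  Incoherence bounds
   |D|_inf^2 by a multiple of mu^m r^* (|D|_F^2 / d^* + |T|_inf^2), and the
   first term is absorbed by the sample size assumption.  As the grid covers
   bounded cores only, the argument is applied to th D for the largest
   th in [0, 1] that makes th Z fit (Q(th D) <= th Q(D) <= 0); the resulting
   bound on th D is too small for th < 1. *)
Require Import Defs.
From HB Require Import structures.
From mathcomp Require Import all_boot all_order all_algebra.
From mathcomp Require Import all_classical all_reals all_analysis.
From mathcomp Require Import measurable_realfun zify ring lra.

Set Implicit Arguments.
Unset Strict Implicit.
Unset Printing Implicit Defensive.

Import Order.TTheory GRing.Theory Num.Theory.
Import numFieldNormedType.Exports.

Local Open Scope classical_set_scope.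
Local Open Scope ring_scope.

(** * Tensors and incoherence *)

(** Generalized distributivity for dependent index types, reached through the bijection with
    [fprod]. It makes sums of rank-one terms over multi-indices factor mode by mode. *)
Lemma sum_dffun_prod (R : comPzSemiRingType) (m : nat) (d : 'I_m -> nat)
    (F : forall j, 'I_(d j) -> R) :
  \sum_(k : multi_index d) \prod_j F j (k j) = \prod_j \sum_a F j a.
Proof.
pose P j : {ffun 'I_(d j) -> R} := [ffun a => F j a].
transitivity (\sum_(t : fprod (fun j => 'I_(d j))) \prod_(j in 'I_m) P j (t j)).
  rewrite (reindex (@dffun_of_fprod _ (fun j => 'I_(d j)))) /=; last first.
    exact/onW_bij/dffun_of_fprod_bij.
  by apply: eq_bigr => t _; apply: eq_bigr => j _; rewrite !ffunE.
rewrite (big_fprod _ _ P) /=.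
rewrite -(bigA_distr_big_dep _ (fun j s => untag 0 (P j) s)).
apply: eq_bigr => j _; rewrite -(big_tag (fun j a => P j a) j).
by apply: eq_bigr => a _; rewrite ffunE.
Qed.

Lemma card_multi_index (m : nat) (d : 'I_m -> nat) :
  #|{: multi_index d}| = dim_prod d.
Proof.
rewrite -sum1_card.
transitivity (\sum_(k : multi_index d) \prod_(j < m) (fun=> 1%N) (k j))%N.
  by apply: eq_bigr => k _; rewrite big1.
rewrite (sum_dffun_prod (fun j (_ : 'I_(d j)) => 1%N)).
by apply: eq_bigr => j _; rewrite sum1_card card_ord.
Qed.

(** Lagrange's identity: the double sum of [(a i * b j - a j * b i) ^+ 2] is twice the difference of
    the two sides. *)
Lemma cauchy_schwarz_sum (R : realDomainType) (I : finType) (a b : I -> R) :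
  (\sum_i a i * b i) ^+ 2 <= (\sum_i a i ^+ 2) * (\sum_i b i ^+ 2).
Proof.
have : 0 <= \sum_i \sum_j (a i * b j - a j * b i) ^+ 2.
  by apply: sumr_ge0 => i _; apply: sumr_ge0 => j _; exact: sqr_ge0.
have -> : \sum_i \sum_j (a i * b j - a j * b i) ^+ 2 =
    \sum_i \sum_j a i ^+ 2 * b j ^+ 2 + \sum_i \sum_j a j ^+ 2 * b i ^+ 2
    - 2 * \sum_i \sum_j (a i * b i) * (a j * b j).
  rewrite mulr_sumr -big_split -sumrB; apply: eq_bigr => i _ /=.
  rewrite mulr_sumr -big_split -sumrB; apply: eq_bigr => j _ /=; ring.
rewrite [X in _ + X - _]exchange_big /= expr2 !big_distrlr /=; lra.
Qed.

Section Tensors.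
Variables (R : realType) (m : nat).
Implicit Types d r : 'I_m -> nat.

Definition sqnorm d (T : tensor R d) : R := \sum_k T k ^+ 2.

Lemma sqnorm_ge0 d (T : tensor R d) : 0 <= sqnorm T.
Proof. by apply: sumr_ge0 => k _; exact: sqr_ge0. Qed.

Lemma le_linf_norm d (T : tensor R d) k : `|T k| <= linf_norm T.
Proof. exact: le_bigmax. Qed.

Lemma linf_norm_ge0 d (T : tensor R d) : 0 <= linf_norm T.
Proof. exact: bigmax_ge_id. Qed.

Lemma linf_norm_le d (T : tensor R d) (a : R) :
  0 <= a -> (forall k, `|T k| <= a) -> linf_norm T <= a.
Proof. by move=> a0 Ta; apply: bigmax_le => // k _; exact: Ta. Qed.

Lemma linf_norm_sqr_le d (T : tensor R d) (a : R) :
  0 <= a -> (forall k, T k ^+ 2 <= a) -> linf_norm T ^+ 2 <= a.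
Proof.
move=> a0 Ta; rewrite -[leRHS](sqr_sqrtr a0) lerXn2r ?nnegrE ?linf_norm_ge0 ?sqrtr_ge0 //.
apply: linf_norm_le => [|k]; first exact: sqrtr_ge0.
by rewrite -sqrtr_sqr ler_sqrt // Ta.
Qed.

Lemma sqnorm_le d (T : tensor R d) (a : R) :
  (forall k, T k ^+ 2 <= a) -> sqnorm T <= (dim_prod d)%:R * a.
Proof.
move=> Ta; apply: le_trans (ler_sum _ (fun k _ => Ta k)) _.
by rewrite sumr_const card_multi_index mulr_natl.
Qed.

Lemma sqnorm_leD d (S T : tensor R d) :
  sqnorm S <= 2 * sqnorm (S - T) + 2 * sqnorm T.
Proof.
rewrite /sqnorm !mulr_sumr -big_split /=; apply: ler_sum => k _.
rewrite !ffunE; have := sqr_ge0 (S k - 2 * T k); nra.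
Qed.

(** Expanding the square gives, for each pair of core indices, a product over the modes of Gram
    entries of the [W j]; orthonormality leaves only the diagonal pairs. *)
Lemma sqnorm_multilinear d r (D : tensor R r)
    (W : forall j, 'M[R]_(d j, r j)) :
  (forall j, orthonormal_cols (W j)) ->
  sqnorm (multilinear_prod D W) = sqnorm D.
Proof.
move=> Wo; rewrite /sqnorm.
under eq_bigr => i _ do rewrite ffunE expr2 big_distrlr /=.
rewrite exchange_big; apply: eq_bigr => k _ /=.
rewrite exchange_big /= (bigD1 k) //= [X in _ + X]big1 => [|l lk].
  rewrite addr0.
  have -> : \sum_(i : multi_index d)
      D k * \prod_j W j (i j) (k j) * (D k * \prod_j W j (i j) (k j))
    = D k ^+ 2 * \sum_(i : multi_index d) \prod_j (W j (i j) (k j) ^+ 2).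
    rewrite mulr_sumr; apply: eq_bigr => i _.
    rewrite prodrXl; ring.
  rewrite (sum_dffun_prod (fun j a => W j a (k j) ^+ 2)) big1 ?mulr1 // => j _.
  have /matrixP/(_ (k j) (k j)) := Wo j; rewrite !mxE eqxx mulr1n => <-.
  by apply: eq_bigr => a _; rewrite !mxE expr2.
have -> : \sum_(i : multi_index d)
      D k * \prod_j W j (i j) (k j) * (D l * \prod_j W j (i j) (l j))
    = D k * D l * \sum_(i : multi_index d) \prod_j (W j (i j) (k j) * W j (i j) (l j)).
  rewrite mulr_sumr; apply: eq_bigr => i _; rewrite big_split /=; ring.
rewrite (sum_dffun_prod (fun j a => W j a (k j) * W j a (l j))).
(* Distinct multi-indices differ in some mode, and the vanishing Gram entry of that mode kills the
   product. *)
have [j klj] : exists j, k j != l j.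
  apply/existsP; apply: contraNT lk; rewrite negb_exists => /forallP kl.
  by apply/eqP/ffunP => j; have := kl j; rewrite negbK => /eqP.
rewrite (bigD1 j) //=.
have /matrixP/(_ (k j) (l j)) := Wo j; rewrite !mxE (negbTE klj) mulr0n => Wkl.
have -> : \sum_a W j a (k j) * W j a (l j) = 0.
  by rewrite -[RHS]Wkl; apply: eq_bigr => a _; rewrite !mxE.
by rewrite mul0r mulr0.
Qed.

(** Cauchy-Schwarz over the core index; the squared weights then sum to a product of squared row
    norms. *)
Lemma multilinear_entry_sqr d r (D : tensor R r)
    (W : forall j, 'M[R]_(d j, r j)) (i : multi_index d) :
  multilinear_prod D W i ^+ 2 <=
    sqnorm D * \prod_j \sum_b W j (i j) b ^+ 2.
Proof.
rewrite ffunE; apply: le_trans (cauchy_schwarz_sum _ _) _.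
rewrite -(sum_dffun_prod (fun j b => W j (i j) b ^+ 2)).
by under [X in _ * X <= _]eq_bigr => k _ do rewrite -prodrXl.
Qed.

End Tensors.

Section Incoherence.
Variables (R : realType) (p q : nat) (W : 'M[R]_(p, q)).

Lemma norm2inf_ge0 : 0 <= norm2inf W.
Proof. exact: bigmax_ge_id. Qed.

Lemma row_sqr_le i : \sum_b W i b ^+ 2 <= norm2inf W ^+ 2.
Proof.
rewrite -[leLHS]sqr_sqrtr; last by apply: sumr_ge0 => b _; exact: sqr_ge0.
rewrite ler_sqr ?nnegrE ?sqrtr_ge0 ?norm2inf_ge0 //.
exact: (le_bigmax _ (fun i => Num.sqrt (\sum_b W i b ^+ 2))).
Qed.

Hypothesis Wo : orthonormal_cols W.

Lemma orthonormal_cols_dim : (q <= p)%N.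
Proof. exact: mulmx1_min Wo. Qed.

Lemma orthonormal_cols_sqr_sum : \sum_i \sum_b W i b ^+ 2 = q%:R.
Proof.
rewrite exchange_big /= -[in RHS](card_ord q) -sumr_const; apply: eq_bigr => b _.
have /matrixP/(_ b b) := Wo; rewrite !mxE eqxx mulr1n => <-.
by apply: eq_bigr => i _; rewrite !mxE expr2.
Qed.

(** The squared row norms add up to [q], so the largest is at least their mean [q / p]. This is what
    later forces [1 <= mu]. *)
Lemma orthonormal_cols_norm2inf : q%:R <= p%:R * norm2inf W ^+ 2.
Proof.
rewrite -orthonormal_cols_sqr_sum.
apply: le_trans (ler_sum _ (fun i _ => row_sqr_le i)) _.
by rewrite sumr_const card_ord mulr_natl.
Qed.

Lemma orthonormal_cols_entry i b : `|W i b| <= 1.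
Proof.
rewrite -(@ler_pXn2r _ 2) ?nnegrE // expr1n real_normK ?num_real //.
have /matrixP/(_ b b) := Wo; rewrite !mxE eqxx mulr1n => <-.
rewrite (bigD1 i) //= mxE -expr2 lerDl.
by apply: sumr_ge0 => k _; rewrite mxE -expr2 sqr_ge0.
Qed.

End Incoherence.

Lemma Inco_norm2inf (R : realType) (p q : nat) (W : 'M[R]_(p, q)) (mu : R) :
  (0 < p)%N -> (0 < q)%N ->
  (Inco W <= mu) = (norm2inf W ^+ 2 <= mu * q%:R / p%:R).
Proof.
move=> p0 q0; rewrite /Inco ler_pdivrMr ?ltr0n // ler_pdivlMr ?ltr0n //.
by rewrite mulrC.
Qed.

(** Each row of [W j] has squared norm at most [mu * r j / d j], and by orthonormality the core has
    the same norm as the whole tensor. This spikiness bound is how incoherence enters the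
    argument. *)
Lemma incoherent_entry_sqr (R : realType) (m : nat) (d r : 'I_m -> nat) (mu : R)
    (D : tensor R r) (W : forall j, 'M[R]_(d j, r j)) (i : multi_index d) :
  (forall j, (0 < r j)%N) ->
  (forall j, orthonormal_cols (W j) /\ Inco (W j) <= mu) ->
  multilinear_prod D W i ^+ 2 <=
    mu ^+ m * (dim_prod r)%:R / (dim_prod d)%:R * sqnorm (multilinear_prod D W).
Proof.
move=> r0 WI; rewrite sqnorm_multilinear => [|j]; last by have [] := WI j.
apply: le_trans (multilinear_entry_sqr _ _ _) _.
rewrite mulrC; apply: ler_wpM2r; first exact: sqnorm_ge0.
have -> : mu ^+ m * (dim_prod r)%:R / (dim_prod d)%:R =
    \prod_(j < m) (mu * (r j)%:R / (d j)%:R).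
  by rewrite /dim_prod !natr_prod !big_split /= prodfV prodr_const card_ord.
apply: ler_prod => j _; apply/andP; split.
  by apply: sumr_ge0 => b _; exact: sqr_ge0.
apply: le_trans (row_sqr_le _ _) _.
have [Wo WI'] := WI j; rewrite -Inco_norm2inf //.
exact: leq_trans (r0 j) (orthonormal_cols_dim Wo).
Qed.

(** * Integrals of products of independent factors *)

Section ProductIntegral.
Local Open Scope ereal_scope.
Context d (T : measurableType d) (R : realType).
Variable P : {measure set T -> \bar R}.

Import HBNNSimple.

(** The last hypothesis is the case where [h] is an indicator; linearity extends it to simple
    functions, and monotone convergence to nonnegative measurable [h]. [G] stands for the factors
    still to be integrated. *)
Lemma le_integral_comp_mul (f : T -> R) (A : set T) (G : T -> R) (C : R)
    (h : R -> R) :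
  measurable_fun setT f -> measurable A -> measurable_fun setT G ->
  (forall x, 0 <= G x)%R -> (0 <= C)%R ->
  measurable_fun setT h -> (forall x, 0 <= h x)%R ->
  (forall B, measurable B ->
     \int[P]_(x in A `&` f @^-1` B) (G x)%:E <= C%:E * P (f @^-1` B)) ->
  \int[P]_(x in A) ((h (f x))%:E * (G x)%:E) <= C%:E * \int[P]_x (h (f x))%:E.
Proof.
move=> mf mA mG G0 C0 mh h0 AB.
have mpre B : measurable B -> measurable (f @^-1` B).
  by move=> mB; rewrite -[X in measurable X]setTI; exact: mf.
have mGE D : measurable_fun D (fun x => (G x)%:E).
  by apply/measurable_EFinP; exact: measurable_funTS.
have step (s : {nnsfun R >-> R}) :
    \int[P]_(x in A) ((s (f x))%:E * (G x)%:E) <= C%:E * \int[P]_x (s (f x))%:E.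
  pose B k := f @^-1` (s @^-1` [set k]).
  have mB k : measurable (B k) by exact/mpre.
  have sfE x : (s (f x))%:E = \sum_(k \in range s) (k * \1_(B k) x)%:E.
    by rewrite {1}fimfunE -fsumEFin.
  have sB0 k x : 0 <= (k * \1_(B k) x)%:E.
    exact: (nnfun_muleindic_ge0 s).
  have mkB k D : measurable_fun D (fun x => (k * \1_(B k) x)%:E).
    by apply/measurable_EFinP/measurable_funM => //; exact: measurable_indic.
  under eq_integral do rewrite sfE ge0_mule_fsuml//.
  under [X in _ <= _ * X]eq_integral do rewrite sfE.
  rewrite ge0_integral_fsum//; last 2 first.
  - move=> k; apply: emeasurable_funM => //; exact: mGE.
  - by move=> k x _; rewrite mule_ge0// lee_fin.
  rewrite ge0_integral_fsum// ge0_mule_fsumr; last first.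
    by move=> k; exact: integral_ge0.
  apply: lee_fsum => // k [y _ <-].
  have k0 : (0 <= s y)%R by [].
  under eq_integral do rewrite EFinM -muleA.
  rewrite ge0_integralZl//; last 2 first.
  - apply: emeasurable_funM; last exact: mGE.
    by apply/measurable_EFinP; exact: measurable_indic.
  - by move=> x _; rewrite mule_ge0// lee_fin//.
  under [X in _ <= _ * X]eq_integral do rewrite EFinM.
  rewrite ge0_integralZl//; last first.
    by apply/measurable_EFinP; exact: measurable_indic.
  rewrite integral_indic// setIT muleCA; apply: lee_wpmul2l; first by rewrite lee_fin.
  apply: le_trans (AB _ (measurable_sfunP s (measurable_set1 _))).
  rewrite le_eqVlt; apply/orP; left; apply/eqP.
  rewrite integral_mkcondr; apply: eq_integral => x _.
  by rewrite patchE indicE /=; case: ifP => _; rewrite ?mul1e ?mul0e.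
have mhE : measurable_fun setT (EFin \o h) by apply/measurable_EFinP.
pose hn := nnsfun_approx measurableT mhE.
have hnh x : ((hn n x)%:E @[n --> \oo] --> (h x)%:E).
  have hE0 z : setT z -> 0 <= (EFin \o h) z by move=> _; rewrite lee_fin.
  exact: (cvg_nnsfun_approx measurableT mhE hE0).
have hn_nd x : {homo hn^~ x : n m / (n <= m)%N >-> (n <= m)%R}.
  by move=> n m nm; exact/lefP/nd_nnsfun_approx.
have mhn n D : measurable_fun D (fun x => (hn n (f x))%:E).
  by apply/measurable_EFinP; apply: measurable_funTS; exact: measurableT_comp.
have hn_le n x : (hn n x <= h x)%R.
  rewrite -lee_fin /hn nnsfun_approxE.
  by apply: (@le_approx _ _ _ setT (EFin \o h)) => // z _; rewrite lee_fin.
rewrite [X in X <= _](_ : _ =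
    \int[P]_(x in A) limn (fun n => (hn n (f x))%:E * (G x)%:E)); last first.
  apply: eq_integral => x _; apply/esym/cvg_lim => //.
  by apply: cvgeZr => //; exact: hnh.
apply: (@cvge_le _ \oo _ _ (fun n => \int[P]_(x in A) ((hn n (f x))%:E * (G x)%:E))); last first.
  apply: cvg_monotone_convergence => //.
  - by move=> n; exact: emeasurable_funM.
  - by move=> n x _; rewrite mule_ge0// lee_fin.
  - by move=> x _ n m nm; rewrite lee_wpmul2r// lee_fin// hn_nd.
apply: nearW => n; apply: le_trans (step _) _.
apply: lee_wpmul2l; first by rewrite lee_fin.
apply: ge0_le_integral => //.
- by move=> x _; rewrite lee_fin.
- by apply/measurable_EFinP; exact: measurableT_comp.
- by move=> x _; rewrite lee_fin.
Qed.

End ProductIntegral.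

Section IndependentProduct.
Local Open Scope ereal_scope.
Context d (T : measurableType d) (R : realType) (P : probability T R).

(** Induction on [s]: the head factor is integrated by [le_integral_comp_mul], whose last hypothesis
    is the induction hypothesis with [A] cut down to the part where [f i] lies in [B]. Hence the
    arbitrary event [A], which later fixes the design. *)
Lemma le_integral_prod_indep (I : eqType) (s : seq I) (f : I -> T -> R)
    (h : I -> R -> R) (e : I -> R) (A : set T) :
  uniq s -> measurable A ->
  (forall i, measurable_fun setT (f i)) ->
  (forall i, measurable_fun setT (h i)) -> (forall i x, 0 <= h i x)%R ->
  (forall i, 0 <= e i)%R ->
  (forall i, \int[P]_x (h i (f i x))%:E <= (e i)%:E) ->
  (forall B : I -> set R, (forall i, measurable (B i)) ->
     P (A `&` \bigcap_(i in [set` s]) (f i @^-1` B i)) =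
     P A * \prod_(i <- s) P (f i @^-1` B i)) ->
  \int[P]_(x in A) (\prod_(i <- s) h i (f i x))%:E <=
    P A * \prod_(i <- s) (e i)%:E.
Proof.
move=> + + mf mh h0 e0 he.
have mfB i B : measurable B -> measurable (f i @^-1` B).
  by move=> mB; rewrite -[X in measurable X]setTI; exact: mf.
elim: s A => [|i s IHs] A /=.
  move=> _ mA _; rewrite big_nil mule1.
  by under eq_integral do rewrite big_nil; rewrite integral_cst// mul1e.
move=> /andP[si us] mA AB.
pose G x := (\prod_(j <- s) h j (f j x))%R.
have mG : measurable_fun setT G.
  by apply: measurable_prod => j _; exact: measurableT_comp.
have G0 x : (0 <= G x)%R by apply: prodr_ge0.
under eq_integral do rewrite big_cons EFinM.
have E0 : (0 <= \prod_(j <- s) e j)%R by apply: prodr_ge0.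
rewrite big_cons prodEFin.
apply: le_trans (@le_integral_comp_mul _ _ _ P (f i) A G
  (fine (P A) * \prod_(j <- s) e j) (h i) _ _ _ _ _ _ _ _) _ => //.
- by rewrite mulr_ge0// fine_ge0.
- move=> B mB.
  have PAB B' : (forall j, measurable (B' j)) ->
      P ((A `&` f i @^-1` B) `&` \bigcap_(j in [set` s]) f j @^-1` B' j) =
      P A * (P (f i @^-1` B) * \prod_(j <- s) P (f j @^-1` B' j)).
    (* [B0] merges the constraint on the head with those on the tail; they cannot clash because [i]
       does not occur in [s]. *)
    move=> mB'; pose B0 j := if j == i then B else B' j.
    have B0s j : j \in s -> B0 j = B' j.
      by rewrite /B0; case: eqP => // -> js; rewrite js in si.
    have B0i : B0 i = B by rewrite /B0 eqxx.
    have <- : \prod_(j <- s) P (f j @^-1` B0 j) = \prod_(j <- s) P (f j @^-1` B' j).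
      by apply: eq_big_seq => j js; rewrite B0s.
    have := AB B0; rewrite big_cons B0i.
    move=> <-; last by move=> j; rewrite /B0; case: ifP.
    rewrite -setIA; congr (P (_ `&` _)); apply/seteqP; split => x /=.
      move=> [xB xs] j; rewrite /= inE => /orP[/eqP->|js]; first by rewrite B0i.
      by rewrite B0s//; exact: xs.
    move=> xB; split; first by rewrite -B0i; apply: xB; rewrite /= inE eqxx.
    by move=> j js; rewrite -B0s//; apply: xB; rewrite /= inE js orbT.
  have PAi : P (A `&` f i @^-1` B) = P A * P (f i @^-1` B).
    have := PAB (fun=> setT) (fun=> measurableT).
    rewrite big1 => [|j _]; last by rewrite preimage_setT probability_setT.
    rewrite mule1 => <-; congr (P _); apply/seteqP; split => x /=; last by case.
    by move=> xAB; split => // j.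
  apply: le_trans (IHs _ us _ _) _.
  + by apply: measurableI => //; exact: mfB.
  + by move=> B' mB'; rewrite PAB// PAi muleA.
  rewrite PAi prodEFin EFinM fineK ?fin_num_measure// -!muleA.
  by rewrite (muleC (P (f i @^-1` B))) lexx.
apply: le_trans (lee_wpmul2l _ (he i)) _; first by rewrite lee_fin mulr_ge0// fine_ge0.
by rewrite EFinM fineK ?fin_num_measure// -!muleA (muleC (e i)%:E).
Qed.

End IndependentProduct.

(** * Scalar inequalities for the exponential *)

Section ExpInequalities.
Variable R : realType.
Implicit Types x y v t : R.

(** For [x > 1] the exponent [2 * x ^+ 2] dominates [x]; otherwise [expR x] is the square of
    [expR (x / 2) <= (1 - x / 2)^-1]. The linear term on the right has mean zero for centered
    noise. *)
Lemma expR_le_quadratic x : expR x <= x + expR (2 * x ^+ 2).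
Proof.
have [x1|x1] := leP x 1; last first.
  rewrite -[leLHS]add0r; apply: lerD; first lra.
  by rewrite ler_expR; nra.
apply: (@le_trans _ _ (1 + x + 2 * x ^+ 2)); last first.
  have := expR_ge1Dx (2 * x ^+ 2); lra.
have h0 : 0 < 1 - x / 2 by lra.
have : expR (- (x / 2)) >= 1 - x / 2 by have := expR_ge1Dx (- (x / 2)); lra.
rewrite expRN => h1.
have h2 : expR (x / 2) <= (1 - x / 2)^-1.
  by rewrite -[leLHS]invrK lef_pV2 // posrE invr_gt0 expR_gt0.
have -> : expR x = expR (x / 2) ^+ 2 by rewrite -expRM_natl; congr expR; lra.
apply: le_trans (_ : (1 - x / 2)^-1 ^+ 2 <= _).
  by rewrite ler_pXn2r ?nnegrE ?expR_ge0 ?invr_ge0 // ltW.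
rewrite exprVn -[leLHS]div1r ler_pdivrMr ?exprn_gt0 //.
(* The factorization exhibits the excess over 1 as nonnegative for [x <= 1]. *)
have -> : (1 + x + 2 * x ^+ 2) * (1 - x / 2) ^+ 2 =
  1 + x ^+ 2 / 4 * ((1 - x) * (5 - 2 * x)) by field.
rewrite lerDl; apply: mulr_ge0; first by rewrite divr_ge0 ?sqr_ge0.
by apply: mulr_ge0; lra.
Qed.

(** Convexity on the segment from 0 to [y]: the tangent at [t * y] is evaluated at both ends and
    averaged with weights [1 - t] and [t]. *)
Lemma expR_convex t y : 0 <= t <= 1 -> expR (t * y) <= 1 - t + t * expR y.
Proof.
move=> /andP[t0 t1].
have ez a : expR (t * y) * (1 + (a - t * y)) <= expR a.
  have -> : expR a = expR (t * y) * expR (a - t * y) by rewrite -expRD; congr expR; ring.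
  by rewrite ler_pM2l ?expR_gt0 //; exact: expR_ge1Dx.
have := ez 0; have := ez y; rewrite expR0; nra.
Qed.

Lemma expRN_le v : 0 <= v <= 1 -> expR (- v) <= 1 - v / 2.
Proof.
move=> /andP[v0 v1].
have : 1 + v <= expR v := expR_ge1Dx v.
rewrite expRN => ev.
have : (expR v)^-1 <= (1 + v)^-1 by rewrite lef_pV2 ?posrE ?expR_gt0 //; lra.
move=> /le_trans; apply; rewrite -div1r ler_pdivrMr; nra.
Qed.

End ExpInequalities.

(** * The deviation inequality *)

Lemma le_measure_bigcup_seq d (T : measurableType d) (R : realType)
    (P : {measure set T -> \bar R}) (I : eqType) (s : seq I) (A : I -> set T) :
  (forall i, measurable (A i)) ->
  (P (\bigcup_(i in [set` s]) A i) <= \sum_(i <- s) P (A i))%E.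
Proof.
move=> mA; elim: s => [|i s IHs].
  by rewrite big_nil (_ : bigcup _ _ = set0) ?measure0 // bigcup0.
have -> : \bigcup_(j in [set` i :: s]) A j = A i `|` \bigcup_(j in [set` s]) A j.
  apply/seteqP; split => [x [j /=]|x [xA|[j js xA]]].
  - rewrite inE => /orP[/eqP->|js xA]; first by left.
    by right; exists j.
  - by exists i; rewrite //= inE eqxx.
  - by exists j; rewrite //= inE js orbT.
rewrite big_cons; apply: le_trans (leeD2l _ IHs).
apply: measureU2 => //; apply: fin_bigcup_measurable => //; exact: finite_seq.
Qed.

Section Noise.
Local Open Scope ereal_scope.
Context disp (Omega : measurableType disp) (R : realType).
Variable P : probability Omega R.

(** By [expR_le_quadratic] the integrand is at most [s * xi] plus an exponential whose exponent is
    [t] times that of the sub-Gaussian hypothesis. As [t <= 1], convexity bounds the latter, and the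
    expectation is at most [1 - t + 2 * t <= expR t]. *)
Lemma subgaussian_mgf (xi : {RV P >-> R}) (c sigma s : R) :
  (0 < c)%R -> (0 < sigma)%R ->
  'E_P[xi] = 0 -> 'E_P[(fun w => xi w ^+ 2)%R] = (sigma ^+ 2)%:E ->
  'E_P[(fun w => expR (c * xi w ^+ 2 / sigma ^+ 2))%R] <= 2%:E ->
  (2 * s ^+ 2 * sigma ^+ 2 <= c)%R ->
  \int[P]_w (expR (s * xi w))%:E <= (expR (2 * s ^+ 2 * sigma ^+ 2 / c))%:E.
Proof.
move=> c0 s0; rewrite !unlock => E1 E2 Ee sc.
set t := (2 * s ^+ 2 * sigma ^+ 2 / c)%R.
have t01 : (0 <= t <= 1)%R.
  rewrite /t ler_pdivrMr// mul1r sc andbT divr_ge0 ?(ltW c0)//.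
  by apply: mulr_ge0; [apply: mulr_ge0|]; rewrite ?sqr_ge0.
have mxi : measurable_fun setT xi by exact: measurable_funPT.
have mxi2 : measurable_fun setT (fun w => (xi w ^+ 2)%R) by exact: measurable_funX.
pose e w := expR (c * xi w ^+ 2 / sigma ^+ 2).
have me : measurable_fun setT e.
  by apply: measurableT_comp => //; apply: measurable_funM => //; apply: measurable_funM.
have ixi2 : P.-integrable setT (EFin \o (fun w => xi w ^+ 2)%R).
  apply/integrableP; split; first exact/measurable_EFinP.
  under eq_integral do rewrite /= ger0_norm ?sqr_ge0//.
  by rewrite E2 ltry.
have ie : P.-integrable setT (EFin \o e).
  apply/integrableP; split; first exact/measurable_EFinP.
  under eq_integral do rewrite /= ger0_norm ?expR_ge0//.
  by rewrite (le_lt_trans Ee)// ltry.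
have i1 k : P.-integrable setT (EFin \o cst k).
  exact: finite_measure_integrable_cst.
have ixi : P.-integrable setT (EFin \o xi).
  apply: (@le_integrable _ _ _ P setT measurableT _
    (EFin \o (cst 1%R \+ (fun w => xi w ^+ 2))%R)) => //.
  - exact/measurable_EFinP.
  - move=> w _; rewrite /= lee_fin [leRHS]ger0_norm; last first.
      by rewrite addr_ge0// sqr_ge0.
    by rewrite ler_norml; apply/andP; split; nra.
  - exact: (integrableD measurableT (i1 1%R) ixi2).
pose g w := (1 - t + t * e w)%R.
have ig : P.-integrable setT (EFin \o g).
  exact: (integrableD measurableT (i1 (1 - t)%R) (integrableZl measurableT t ie)).
have isx : P.-integrable setT (fun w => s%:E * (EFin \o xi) w).
  exact: integrableZl.
apply: (@le_trans _ _ (\int[P]_w (s%:E * (EFin \o xi) w + (EFin \o g) w))).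
  have le_g w : (expR (s * xi w) <= s * xi w + g w)%R.
    apply: le_trans (expR_le_quadratic _) _; rewrite lerD2l.
    have <- : (t * (c * xi w ^+ 2 / sigma ^+ 2) = 2 * (s * xi w) ^+ 2)%R.
      by rewrite /t; field; rewrite !gt_eqF.
    exact: expR_convex.
  apply: ge0_le_integral => //.
  - apply/measurable_EFinP/measurableT_comp => //; exact: measurable_funM.
  - apply: emeasurable_funD; first exact: measurable_int isx.
    exact: measurable_int ig.
  - by move=> w _; rewrite /= -EFinM -EFinD lee_fin le_g.
rewrite integralD// integralZl//.
have -> : \int[P]_w (EFin \o xi) w = 0 by exact: E1.
rewrite mule0 add0e.
have -> : \int[P]_w (EFin \o g) w = (1 - t)%:E + t%:E * \int[P]_w (e w)%:E.
  transitivity (\int[P]_w ((EFin \o cst (1 - t)%R) w + t%:E * (EFin \o e) w)).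
    by apply: eq_integral => w _; rewrite /= -EFinM -EFinD.
  rewrite integralD//; last exact: integrableZl.
  rewrite integralZl//; congr (_ + _).
  by have := expectation_cst P (1 - t)%R; rewrite unlock.
apply: (@le_trans _ _ (1 + t)%:E); last by rewrite lee_fin expR_ge1Dx.
apply: (@le_trans _ _ ((1 - t)%:E + t%:E * 2%:E)).
  by rewrite leeD2l// lee_wpmul2l// lee_fin; case/andP: t01.
by rewrite -EFinM -EFinD lee_fin; lra.
Qed.

End Noise.

Lemma tensor_dot_basis (R : realType) (m : nat) (d : 'I_m -> nat)
    (T : tensor R d) (k : multi_index d) : tensor_dot T (basis_tensor R k) = T k.
Proof.
rewrite /tensor_dot (bigD1 k) //= ffunE eqxx mulr1 big1 ?addr0 // => l lk.
by rewrite ffunE (negbTE lk) mulr0.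
Qed.

(** * Random design, split over the finitely many sampled positions *)

Section Sampling.
Context disp (Omega : measurableType disp) (R : realType).
Variable P : probability Omega R.
Variables (m n : nat) (d : 'I_m -> nat).
Variables (X : 'I_n -> Omega -> tensor R d) (xi : 'I_n -> {RV P >-> R}).
Hypothesis X_random : forall i, random_tensor (X i).
Hypothesis X_uniform : forall i, uniform_on_basis P (X i).
Hypothesis X_xi_indep : design_noise_independent P X xi.

Lemma basis_eventE i k : [set w | X i w = basis_tensor R k] =
  \bigcap_(l in [set: multi_index d])
    ((fun w => X i w l) @^-1` [set basis_tensor R k l]).
Proof.
apply/seteqP; split => w /= Xk; first by move=> l _ /=; rewrite Xk.
by apply/ffunP => l; exact: Xk.
Qed.

Lemma sigma_tensor_basis i k :
  sigma_tensor (X i) [set w | X i w = basis_tensor R k].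
Proof.
rewrite basis_eventE.
apply: (@fin_bigcap_measurable _ (g_sigma_algebraType
  [set A | exists l, sigma_real (fun w => X i w l) A])) => [|l _].
  exact: finite_finset.
apply: sub_sigma_algebra; exists l; exists [set basis_tensor R k l] => //.
by rewrite setTI.
Qed.

Lemma measurable_basis_event i k :
  measurable [set w | X i w = basis_tensor R k].
Proof.
rewrite basis_eventE; apply: fin_bigcap_measurable => [|l _]; first exact: finite_finset.
by rewrite -[X in measurable X]setTI; exact: X_random.
Qed.

(** Conditioning on the design is replaced by splitting over these finitely many events, on each of
    which only the noise is random. *)
Definition design_event (k : 'I_n -> multi_index d) : set Omega :=
  [set w | forall i, X i w = basis_tensor R (k i)].

Lemma measurable_design_event k : measurable (design_event k).
Proof.
have -> : design_event k =
    \bigcap_(i in [set: 'I_n]) [set w | X i w = basis_tensor R (k i)].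
  by apply/seteqP; split => w /= kw i; [move=> _|]; exact: kw.
apply: fin_bigcap_measurable => [|i _]; first exact: finite_finset.
exact: measurable_basis_event.
Qed.

Local Open Scope ereal_scope.

(** Independence is invoked for all [2 n] variables at once, with one design event and one noise
    event per sample. *)
Lemma design_noise_prob k (B : 'I_n -> set R) :
  (forall i, measurable (B i)) ->
  P (design_event k `&` \bigcap_(i in [set: 'I_n]) (xi i @^-1` B i)) =
  ((dim_prod d)%:R ^- n)%:E * \prod_i P (xi i @^-1` B i).
Proof.
move=> mB.
pose E (s : 'I_n + 'I_n) := match s with
  | inl i => [set w | X i w = basis_tensor R (k i)]
  | inr i => xi i @^-1` B i end.
have := X_xi_indep (J := finset.setT) (E := E).
have -> : \bigcap_(s in [set` finset.setT]) E s =
    design_event k `&` \bigcap_(i in [set: 'I_n]) (xi i @^-1` B i).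
  apply/seteqP; split => [w /= Ew|w [/= kw Bw] [i|i] _]; last 2 first.
  - exact: kw.
  - exact: Bw.
  split => [i|i _]; first by have := Ew (inl i); rewrite /= inE; exact.
  by have := Ew (inr i); rewrite /= inE; exact.
move=> ->.
  under eq_bigl do rewrite inE.
  rewrite big_sumType /=; congr (_ * _).
  under eq_bigr do rewrite X_uniform.
  by rewrite prodEFin prodr_const card_ord exprVn.
move=> [i|i] _; first exact: sigma_tensor_basis.
by exists (B i) => //; rewrite setTI.
Qed.

Lemma design_event_prob k : P (design_event k) = ((dim_prod d)%:R ^- n)%:E.
Proof.
have := design_noise_prob k (fun=> measurableT).
rewrite big1 ?mule1 => [|i _]; last by rewrite preimage_setT probability_setT.
by rewrite (_ : bigcap _ _ = setT) ?setIT// bigcapT.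
Qed.

(** Uniformity prescribes only the masses of the basis tensors, so other values are excluded almost
    surely rather than everywhere. *)
Definition sampled_basis : set Omega :=
  [set w | forall i, exists k, X i w = basis_tensor R k].

Lemma sampled_basisE : sampled_basis =
  \bigcup_(k in [set` index_enum {ffun 'I_n -> multi_index d}]) design_event k.
Proof.
apply/seteqP; split => w /=.
  move=> Xw; have /choice[k Xk] := Xw.
  by exists (finfun k) => /=; [rewrite mem_index_enum|move=> i; rewrite ffunE].
by move=> [k _ kw] i; exists (k i).
Qed.

Lemma measurable_sampled_basis : measurable sampled_basis.
Proof.
rewrite sampled_basisE; apply: fin_bigcup_measurable; first exact: finite_seq.
by move=> k _; exact: measurable_design_event.
Qed.

(** There are [dim_prod d ^ n] disjoint design events, each of mass [dim_prod d ^- n]. *)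
Lemma sampled_basis_prob : (0 < dim_prod d)%N -> P sampled_basis = 1.
Proof.
move=> d0; rewrite sampled_basisE measure_fin_bigcup; last 3 first.
- exact: finite_seq.
- move=> k l _ _ [w [kw lw]]; apply/ffunP => i; apply/eqP.
  have /ffunP/(_ (k i)) : basis_tensor R (k i) = basis_tensor R (l i).
    by rewrite -kw lw.
  by rewrite !ffunE eqxx; case: eqP => // _ /eqP; rewrite oner_eq0.
- by move=> k _; exact: measurable_design_event.
rewrite -fsbig_seq ?index_enum_uniq//.
transitivity (\sum_(k : {ffun 'I_n -> multi_index d}) ((dim_prod d)%:R ^- n)%:E : \bar R).
  by apply: eq_bigr => k _; exact: design_event_prob.
rewrite sumEFin sumr_const card_ffun card_multi_index card_ord -[X in X%:E]mulr_natl.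
by rewrite natrX divff// expf_neq0// pnatr_eq0 -lt0n.
Qed.

(** The sum of squared residuals at [T + D] minus the one at [T], when [z] is the noise around the
    truth [T]. *)
Definition excess_loss (D : tensor R d) (x : 'I_n -> tensor R d) (z : 'I_n -> R) : R :=
  \sum_i (tensor_dot D (x i) ^+ 2 - 2 * z i * tensor_dot D (x i)).

(** The unfavourable event. Intersecting with [sampled_basis] makes it a finite union of pieces with
    a frozen design, hence measurable. *)
Definition deviation_event (D : tensor R d) (a : R) : set Omega :=
  sampled_basis `&`
    [set w | (excess_loss D (fun i => X i w) (fun i => xi i w) < a)%R].

Let basis_excess D (k : 'I_n -> multi_index d) w : R :=
  excess_loss D (fun i => basis_tensor R (k i)) (fun i => xi i w).

Let mxi i : measurable_fun setT (xi i). Proof. exact: measurable_funPT. Qed.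

Let measurable_basis_excess D k : measurable_fun setT (basis_excess D k).
Proof.
apply: measurable_sum => i; apply: measurable_funB => //.
by apply: measurable_funM => //; exact: measurable_funM.
Qed.

Let measurable_basis_excess_lt D k a :
  measurable [set w | (basis_excess D k w < a)%R].
Proof.
have -> : [set w | (basis_excess D k w < a)%R] =
    basis_excess D k @^-1` `]-oo, a[%classic.
  by apply/seteqP; split => w /=; rewrite in_itv.
by rewrite -[X in measurable X]setTI; exact: measurable_basis_excess.
Qed.

Let deviation_eventE D a : deviation_event D a =
  \bigcup_(k in [set` index_enum {ffun 'I_n -> multi_index d}])
    (design_event k `&` [set w | (basis_excess D k w < a)%R]).
Proof.
rewrite /deviation_event sampled_basisE setI_bigcupl; apply: eq_bigcupr => k _.
apply/seteqP; split => w /= [kw].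
  suff -> : (fun i => X i w) = (fun i => basis_tensor R (k i)) by [].
  by apply/funext => i; exact: kw.
suff -> : (fun i => X i w) = (fun i => basis_tensor R (k i)) by [].
by apply/funext => i; exact: kw.
Qed.

Lemma measurable_deviation_event D a : measurable (deviation_event D a).
Proof.
rewrite deviation_eventE; apply: fin_bigcup_measurable; first exact: finite_seq.
by move=> k _; apply: measurableI => //; exact: measurable_design_event.
Qed.

Variables (c sigma : R).
Hypotheses (c_gt0 : (0 < c)%R) (sigma_gt0 : (0 < sigma)%R).
Hypothesis xi_mean : forall i, 'E_P[xi i] = 0.
Hypothesis xi_var : forall i, 'E_P[(fun w => xi i w ^+ 2)%R] = (sigma ^+ 2)%:E.
Hypothesis xi_psi2 : forall i,
  'E_P[(fun w => expR (c * xi i w ^+ 2 / sigma ^+ 2))%R] <= 2%:E.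

(* [s = 2 lam a] satisfies the smallness condition of [subgaussian_mgf], and
   [lam <= c / (16 sigma^2)] makes the resulting factor at most
   [expR (lam * a ^+ 2 / 2)]. *)
Lemma noise_factor (a lam : R) i : (0 < lam)%R -> (16 * sigma ^+ 2 * lam <= c)%R ->
  (lam * a ^+ 2 <= 1)%R ->
  \int[P]_w (expR (- (lam * (a ^+ 2 - 2 * xi i w * a))))%:E <=
    (1 - lam * a ^+ 2 / 4)%:E.
Proof.
move=> lam0 lamc lama.
have s20 : (0 < sigma ^+ 2)%R by rewrite exprn_gt0.
have a20 := sqr_ge0 a.
have la0 : (0 <= lam * a ^+ 2)%R by rewrite mulr_ge0// ltW.
have sla : (16 * sigma ^+ 2 * lam * (lam * a ^+ 2) <= c * (lam * a ^+ 2))%R.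
  exact: ler_wpM2r.
rewrite [leLHS](_ : _ = \int[P]_w ((expR (- (lam * a ^+ 2)))%:E *
    (expR (2 * lam * a * xi i w))%:E)); last first.
  by apply: eq_integral => w _; rewrite -EFinM -expRD; congr (expR _)%:E; ring.
rewrite ge0_integralZl_EFin ?expR_ge0//; last first.
  by apply/measurable_EFinP/measurableT_comp => //; exact: measurable_funM.
have mgf := @subgaussian_mgf _ _ _ P (xi i) c sigma (2 * lam * a)%R
  c_gt0 sigma_gt0 (xi_mean i) (xi_var i) (xi_psi2 i) _.
apply: le_trans (lee_wpmul2l _ (mgf _)) _; first by rewrite lee_fin expR_ge0.
  have -> : (2 * (2 * lam * a) ^+ 2 * sigma ^+ 2 =
    (16 * sigma ^+ 2 * lam * (lam * a ^+ 2)) / 2)%R by field.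
  nra.
rewrite -EFinM lee_fin -expRD.
apply: (@le_trans _ _ (expR (- (lam * a ^+ 2 / 2)))).
  rewrite ler_expR.
  have -> : (2 * (2 * lam * a) ^+ 2 * sigma ^+ 2 / c =
     (16 * sigma ^+ 2 * lam * (lam * a ^+ 2)) / c / 2)%R by field; rewrite gt_eqF.
  have : (16 * sigma ^+ 2 * lam * (lam * a ^+ 2) / c <= lam * a ^+ 2)%R.
    by rewrite ler_pdivrMr// [leRHS]mulrC.
  lra.
apply: le_trans (expRN_le _) _; lra.
Qed.

(** An exponential Markov bound on each design event, followed by a sum over the designs. The mean
    of [1 - lam * D k ^+ 2 / 4] over the entries is at most [expR (- (lam * sqnorm D / (4 * dim_prod
    d)))], and the threshold is set so that the final exponent is [- t]. *)
Lemma deviation_event_prob (D : tensor R d) (lam t : R) :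
  (0 < dim_prod d)%N ->
  (0 < lam)%R -> (16 * sigma ^+ 2 * lam <= c)%R ->
  (forall k, lam * D k ^+ 2 <= 1)%R ->
  P (deviation_event D (n%:R * sqnorm D / (4 * (dim_prod d)%:R) - t / lam)) <=
    (expR (- t))%:E.
Proof.
move=> d0 lam0 lamc lamD; set a := (_ - t / lam)%R.
have H0 : (0 < (dim_prod d)%:R :> R)%R by rewrite ltr0n.
pose h i0 x := expR (- (lam * (D i0 ^+ 2 - 2 * x * D i0))).
pose e i0 := (1 - lam * D i0 ^+ 2 / 4)%R.
have e0 i0 : (0 <= e i0)%R by rewrite /e; have := lamD i0; lra.
have mh i0 : measurable_fun setT (h i0).
  apply: measurableT_comp => //; apply: measurableT_comp => //.
  apply: measurable_funM => //; apply: measurable_funB => //.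
  by apply: measurable_funM => //; exact: measurable_funM.
have expR_basis_excess k w : expR (- (lam * basis_excess D k w)) =
    (\prod_(i <- index_enum 'I_n) h (k i) (xi i w))%R.
  rewrite /basis_excess /excess_loss mulr_sumr -sumrN expR_sum.
  by apply: eq_bigr => i _; rewrite tensor_dot_basis.
rewrite deviation_eventE.
apply: le_trans (le_measure_bigcup_seq _ _ _) _.
  by move=> k; apply: measurableI => //; exact: measurable_design_event.
have term k : P (design_event k `&` [set w | (basis_excess D k w < a)%R]) <=
    (expR (lam * a) * \prod_i (e (k i) / (dim_prod d)%:R))%:E.
  have mA := measurable_design_event k.
  have mG : measurable_fun setT (fun w =>
      (\prod_(i <- index_enum 'I_n) h (k i) (xi i w))%:E).
    apply/measurable_EFinP/measurable_prod => i _.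
    exact: measurableT_comp (mh _) (mxi _).
  have G0 w : (0 <= \prod_(i <- index_enum 'I_n) h (k i) (xi i w))%R.
    by apply: prodr_ge0 => i _; exact: expR_ge0.
  (* On the event, [expR (lam * (a - excess))] is at least 1, so its integral dominates the
     probability. *)
  apply: (@le_trans _ _ ((expR (lam * a))%:E * \int[P]_(w in design_event k)
     (\prod_(i <- index_enum 'I_n) h (k i) (xi i w))%:E)).
    rewrite -ge0_integralZl_EFin ?expR_ge0//; last 2 first.
    - by move=> w _; rewrite lee_fin.
    - exact: measurable_funTS.
    rewrite -[leLHS]mul1e -integral_cst//; last exact: measurableI.
    apply: (@le_trans _ _ (\int[P]_(w in design_event k `&` [set w | (basis_excess D k w < a)%R])
       ((expR (lam * a))%:E * (\prod_(i <- index_enum 'I_n) h (k i) (xi i w))%:E))).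
      apply: ge0_le_integral => //; first exact: measurableI.
      - by apply: measurable_funTS; exact: measurable_funeM.
      - move=> w [_ /= wa]; rewrite -EFinM lee_fin -expR_basis_excess -expRD.
        by rewrite -expR0 ler_expR -mulrBr mulr_ge0// ltW// subr_gt0.
    apply: ge0_subset_integral => //.
    - exact: measurableI.
    - by apply: measurable_funTS; exact: measurable_funeM.
    - by move=> w _; rewrite -EFinM lee_fin mulr_ge0// expR_ge0.
  rewrite EFinM; apply: lee_wpmul2l; first by rewrite lee_fin expR_ge0.
  apply: le_trans (le_integral_prod_indep (h := fun i => h (k i))
    (e := fun i => e (k i)) _ _ _ _ _ _ _ _) _ => //.
  - exact: index_enum_uniq.
  - by move=> i x; exact: expR_ge0.
  - by move=> i; exact: noise_factor.
  - move=> B mB; rewrite design_event_prob -(design_noise_prob k mB).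
    congr (P (_ `&` _)); apply/seteqP; split => w Bw i _; last exact: Bw.
    by apply: Bw; rewrite /= mem_index_enum.
  rewrite design_event_prob prodEFin -EFinM lee_fin big_split /= prodr_const.
  by rewrite card_ord exprVn mulrC.
apply: (@le_trans _ _ (\sum_(k : {ffun 'I_n -> multi_index d})
    (expR (lam * a) * \prod_i (e (k i) / (dim_prod d)%:R))%:E)).
  by apply: lee_sum => k _; exact: term.
rewrite sumEFin lee_fin -mulr_sumr.
(* Summed over all designs, the product becomes the [n]-th power of an average over the entries of
   [D]. *)
rewrite -(bigA_distr_bigA (fun=> fun k => (e k / (dim_prod d)%:R)%R)).
rewrite prodr_const card_ord.
have S0 : (0 <= \sum_k e k / (dim_prod d)%:R)%R.
  by apply: sumr_ge0 => k _; rewrite divr_ge0// ltW.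
have SE : (\sum_k e k / (dim_prod d)%:R =
    1 - lam * sqnorm D / (4 * (dim_prod d)%:R))%R.
  rewrite -mulr_suml /e sumrB sumr_const card_multi_index -mulr_suml -mulr_sumr /sqnorm.
  by field; rewrite gt_eqF.
apply: (@le_trans _ _ (expR (lam * a) *
    expR (- (lam * sqnorm D / (4 * (dim_prod d)%:R))) ^+ n)%R).
  rewrite ler_wpM2l ?expR_ge0// lerXn2r ?nnegrE ?expR_ge0// SE.
  exact: expR_ge1Dx.
rewrite -expRM_natl -expRD le_eqVlt; apply/orP; left; apply/eqP; congr expR.
by rewrite /a; field; rewrite !gt_eqF.
Qed.

Let noise_energy w : R := (\sum_i xi i w ^+ 2)%R.

Let noise_energy_ge0 w : (0 <= noise_energy w)%R.
Proof. by apply: sumr_ge0 => i _; exact: sqr_ge0. Qed.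

Let measurable_noise_energy : measurable_fun setT noise_energy.
Proof. by apply: measurable_sum => i; exact: measurable_funX. Qed.

Let measurable_noise_energy_gt a : measurable [set w | (a < noise_energy w)%R].
Proof.
have -> : [set w | (a < noise_energy w)%R] = noise_energy @^-1` `]a, +oo[%classic.
  by apply/seteqP; split => w /=; rewrite in_itv /= andbT.
by rewrite -[X in measurable X]setTI; exact: measurable_noise_energy.
Qed.

(** Markov's inequality, the energy having mean [n * sigma ^+ 2]. Such a weak tail suffices because
    the energy only controls the rounding error. *)
Lemma noise_energy_prob (q : R) : (0 < n)%N -> (0 < q)%R ->
  P [set w | (n%:R * sigma ^+ 2 * q < \sum_i xi i w ^+ 2)%R] <= (q^-1)%:E.
Proof.
move=> n0 q0; set a := (n%:R * sigma ^+ 2 * q)%R.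
have ns0 : (0 < n%:R * sigma ^+ 2 :> R)%R by rewrite mulr_gt0 ?ltr0n ?exprn_gt0.
have a0 : (0 < a)%R by rewrite mulr_gt0.
have int_energy : \int[P]_w (noise_energy w)%:E = (n%:R * sigma ^+ 2)%:E.
  under eq_integral do rewrite -sumEFin.
  rewrite ge0_integral_sum//; last 2 first.
  - by move=> i; apply/measurable_EFinP; exact: measurable_funX.
  - by move=> i w _; rewrite lee_fin sqr_ge0.
  transitivity (\sum_(i < n) (sigma ^+ 2)%:E : \bar R).
    by apply: eq_bigr => i _; rewrite -(xi_var i) unlock.
  by rewrite sumEFin sumr_const card_ord mulr_natl.
have : a%:E * P [set w | (a < noise_energy w)%R] <= (n%:R * sigma ^+ 2)%:E.
  rewrite -int_energy -integral_cst//.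
  apply: (@le_trans _ _ (\int[P]_(w in [set w | (a < noise_energy w)%R]) (noise_energy w)%:E)).
    apply: ge0_le_integral => //.
    - by move=> w _; rewrite lee_fin ltW.
    - by apply/measurable_EFinP; exact: measurable_funTS.
    - by move=> w /= aw; rewrite lee_fin ltW.
  apply: ge0_subset_integral => //; first exact/measurable_EFinP.
  by move=> w _; rewrite lee_fin.
rewrite -lee_pdivlMl// => /le_trans; apply.
by rewrite -EFinM lee_fin /a invfM mulrAC mulVf ?mul1r// gt_eqF.
Qed.

(** The complement of [E] unites a null set, the event of large noise energy, and one deviation
    event per member of the family. *)
Lemma uniform_deviation (N : finType) (F : N -> tensor R d) (t q : R) :
  (0 < dim_prod d)%N -> (0 < n)%N -> (0 < q)%R ->
  exists E : set Omega, [/\ measurable E,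
    P E >= (1 - (q^-1 + #|N|%:R * expR (- t)))%:E &
    forall w, E w -> [/\ sampled_basis w,
      (\sum_i xi i w ^+ 2 <= n%:R * sigma ^+ 2 * q)%R &
      forall g, (n%:R * sqnorm (F g) / (4 * (dim_prod d)%:R)
          - t * (16 * sigma ^+ 2 / c + linf_norm (F g) ^+ 2) <=
        excess_loss (F g) (fun i => X i w) (fun i => xi i w))%R]].
Proof.
move=> d0 n0 q0.
(* The reciprocal of the sum meets both requirements of the Chernoff bound:
   [16 * sigma ^+ 2 * lam <= c] and [lam * F g k ^+ 2 <= 1]. *)
pose lam g := ((16 * sigma ^+ 2 / c + linf_norm (F g) ^+ 2)^-1)%R.
pose a g := (n%:R * sqnorm (F g) / (4 * (dim_prod d)%:R) - t / lam g)%R.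
pose dev := \bigcup_(g in [set` index_enum N]) deviation_event (F g) (a g).
pose noisy := [set w | (n%:R * sigma ^+ 2 * q < noise_energy w)%R].
have s0 : (0 < 16 * sigma ^+ 2 / c)%R by rewrite divr_gt0 ?mulr_gt0 ?exprn_gt0.
have lam0' g : (0 < 16 * sigma ^+ 2 / c + linf_norm (F g) ^+ 2)%R.
  by rewrite ltr_pwDl// sqr_ge0.
have mdev : measurable dev.
  apply: fin_bigcup_measurable; first exact: finite_seq.
  by move=> g _; exact: measurable_deviation_event.
have mnoisy : measurable noisy by exact: measurable_noise_energy_gt.
have mS : measurable (~` sampled_basis).
  by apply: measurableC; exact: measurable_sampled_basis.
have mnd : measurable (noisy `|` dev) by exact: measurableU.
have mbad : measurable (~` sampled_basis `|` (noisy `|` dev)).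
  exact: measurableU.
exists (~` (~` sampled_basis `|` (noisy `|` dev))); split.
- exact: measurableC.
- rewrite probability_setC// EFinB leeD2l// leeN2.
  have PS0 : P (~` sampled_basis) = 0.
    rewrite probability_setC ?sampled_basis_prob ?subee//.
    exact: measurable_sampled_basis.
  have PU : P (~` sampled_basis `|` (noisy `|` dev)) <=
    P (~` sampled_basis) + P (noisy `|` dev) := measureU2 P mS mnd.
  rewrite PS0 add0e in PU; apply: le_trans PU _.
  apply: le_trans (measureU2 P mnoisy mdev) _.
  rewrite EFinD; apply: leeD; first exact: noise_energy_prob.
  apply: le_trans (le_measure_bigcup_seq _ _ _) _.
    by move=> g; exact: measurable_deviation_event.
  apply: (@le_trans _ _ (\sum_(g : N) (expR (- t))%:E)).
    apply: lee_sum => g _; apply: deviation_event_prob => //.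
    + by rewrite invr_gt0.
    + rewrite /lam ler_pdivrMr//.
      have -> : (c * (16 * sigma ^+ 2 / c + linf_norm (F g) ^+ 2) =
        16 * sigma ^+ 2 + c * linf_norm (F g) ^+ 2)%R by field; rewrite gt_eqF.
      by rewrite lerDl mulr_ge0 ?sqr_ge0// ltW.
    + move=> k; rewrite /lam mulrC ler_pdivrMr// mul1r.
      rewrite -[leLHS]add0r; apply: lerD; first exact: ltW.
      by rewrite -real_normK ?num_real// lerXn2r ?nnegrE ?le_linf_norm// linf_norm_ge0.
  by rewrite sumEFin sumr_const mulr_natl.
move=> w; rewrite !setCU !setCK => -[wS [wn wd]]; split => //.
  by rewrite leNgt; apply/negP => wn'; exact: wn.
move=> g; have -> : (t * (16 * sigma ^+ 2 / c + linf_norm (F g) ^+ 2) = t / lam g)%R.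
  by rewrite /lam invrK.
rewrite leNgt; apply/negP => wg; apply: wd; exists g; last by split.
by rewrite /= mem_index_enum.
Qed.

End Sampling.

(** * Discretization of the low rank tensors *)

(** Telescoping: the factors are exchanged one at a time, the others having modulus at most 1. *)
Lemma prod_diff_le (R : realDomainType) (I : Type) (s : seq I) (a b : I -> R) (e : R) :
  (forall i, `|a i| <= 1) -> (forall i, `|b i| <= 1) ->
  (forall i, `|a i - b i| <= e) ->
  `|\prod_(i <- s) a i - \prod_(i <- s) b i| <= (size s)%:R * e.
Proof.
move=> a1 b1 ab.
have prod1 (f : I -> R) (u : seq I) :
    (forall i, `|f i| <= 1) -> `|\prod_(i <- u) f i| <= 1.
  by move=> f1; rewrite normr_prod; apply: prodr_ile1 => i; rewrite normr_ge0 f1.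
elim: s => [|i s IHs]; first by rewrite !big_nil subrr normr0 mul0r.
rewrite !big_cons.
have -> : a i * \prod_(j <- s) a j - b i * \prod_(j <- s) b j =
  (a i - b i) * \prod_(j <- s) a j + b i * (\prod_(j <- s) a j - \prod_(j <- s) b j).
  by ring.
apply: le_trans (ler_normD _ _) _; rewrite !normrM /= -natr1 mulrDl mul1r addrC.
apply: lerD.
  by apply: le_trans (ler_wpM2r _ (b1 i)) _; rewrite ?mul1r.
by apply: le_trans (ler_wpM2l _ (prod1 a s a1)) _; rewrite ?mulr1.
Qed.

Section Net.
Variables (R : realType) (m : nat) (d r : 'I_m -> nat).

(* [None] is the weight of the fixed tensor in [param_tensor], the other indices
   are the entries of the core and of the factors. *)
Definition param : finType :=
  option (multi_index r + {j : 'I_m & ('I_(d j) * 'I_(r j))%type}).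

Definition factor_param j (a : 'I_(d j)) (b : 'I_(r j)) : param :=
  Some (inr (Tagged (fun j => ('I_(d j) * 'I_(r j))%type) (a, b))).

Lemma card_param : #|param| = (dim_prod r + \sum_j d j * r j).+1.
Proof.
rewrite card_option card_sum card_multi_index card_tagged; congr (_ + _).+1.
rewrite sumnE big_map big_enum /=; apply: eq_bigr => j _.
by rewrite card_prod !card_ord.
Qed.

Definition param_tensor (M : R) (T : tensor R d) (p : param -> R) : tensor R d :=
  [ffun i => M * multilinear_prod [ffun k => p (Some (inl k))]
      (fun j => \matrix_(a, b) p (factor_param a b)) i
    - p None * T i].

Lemma param_tensor_lipschitz (M e : R) (T : tensor R d) (p q : param -> R) i :
  0 <= M ->
  (forall a, `|p a| <= 1) -> (forall a, `|q a| <= 1) ->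
  (forall a, `|p a - q a| <= e) ->
  `|param_tensor M T p i - param_tensor M T q i| <=
    (M * (dim_prod r)%:R * m.+1%:R + linf_norm T) * e.
Proof.
move=> M0 p1 q1 pq; rewrite !ffunE.
rewrite [X in `|X|](_ : _ = M * (\sum_(k : multi_index r)
   ([ffun k => p (Some (inl k))] k *
     \prod_j (\matrix_(a, b) p (factor_param a b)) (i j) (k j) -
   [ffun k => q (Some (inl k))] k *
     \prod_j (\matrix_(a, b) q (factor_param a b)) (i j) (k j)))
   - (p None - q None) * T i); last by rewrite sumrB; ring.
apply: le_trans (ler_normB _ _) _; rewrite [leRHS]mulrDl; apply: lerD; last first.
  rewrite normrM mulrC; apply: ler_pM => //; exact: le_linf_norm.
rewrite normrM (ger0_norm M0) -!mulrA; apply: ler_wpM2l => //.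
apply: le_trans (ler_norm_sum _ _ _) _.
rewrite mulr_natl -card_multi_index -sumr_const; apply: ler_sum => k _.
rewrite !ffunE; under eq_bigr do rewrite mxE.
under [X in _ - _ * X]eq_bigr do rewrite mxE.
(* The core entry is placed at index [ord0] as one more factor, giving products of [m.+1] numbers of
   modulus at most 1. *)
pose f (p : param -> R) (a : 'I_m.+1) : R := match unlift ord0 a with
  | None => p (Some (inl k))
  | Some j => p (factor_param (i j) (k j)) end.
have fE p' : p' (Some (inl k)) * \prod_j p' (factor_param (i j) (k j))
   = \prod_(a < m.+1) f p' a.
  rewrite big_ord_recl /f unlift_none; congr (_ * _).
  by apply: eq_bigr => j _; rewrite liftK.
rewrite !fE.
have := @prod_diff_le R _ (index_enum 'I_m.+1) (f p) (f q) e.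
have -> : size (index_enum 'I_m.+1) = m.+1.
  by rewrite /index_enum -enumT size_enum_ord.
by apply => a; rewrite /f; case: unlift.
Qed.

Definition grid (L : nat) (i : 'I_(2 * L).+1) : R := i%:R / L%:R - 1.

Lemma grid_le1 L i : (0 < L)%N -> `|@grid L i| <= 1.
Proof.
move=> L0; have L0' : 0 < L%:R :> R by rewrite ltr0n.
have iL : (i <= 2 * L)%N by rewrite -ltnS.
rewrite ler_norml /grid; apply/andP; split.
  by rewrite lerBrDr addNr divr_ge0.
by rewrite lerBlDr ler_pdivrMr // -[1 + 1]/(2%:R) -natrM ler_nat.
Qed.

Lemma grid_approx L (x : R) : (0 < L)%N -> `|x| <= 1 ->
  exists i : 'I_(2 * L).+1, `|x - grid i| <= L%:R^-1.
Proof.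
move=> L0 /ler_normlP[x1 x2]; have L0' : 0 < L%:R :> R by rewrite ltr0n.
have y0 : 0 <= (x + 1) * L%:R by rewrite mulr_ge0 //; lra.
(* Rounding down sends [x = 1] to the index [2 * L], whence [2 * L + 1] grid points. *)
have iL : (Num.truncn ((x + 1) * L%:R) < (2 * L).+1)%N.
  rewrite ltnS -(@ler_nat R).
  apply: le_trans (_ : (x + 1) * L%:R <= _).
    by have /andP[] := truncn_itv y0.
  by rewrite natrM ler_wpM2r //; lra.
exists (Ordinal iL); rewrite /grid /=; set k := Num.truncn _.
have /andP[k1 k2] : k%:R <= (x + 1) * L%:R < k.+1%:R by apply: truncn_itv.
have -> : x - (k%:R / L%:R - 1) = ((x + 1) * L%:R - k%:R) / L%:R.
  by field; rewrite gt_eqF.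
rewrite normrM [X in _ * X]ger0_norm ?invr_ge0 //.
rewrite -[leRHS]mul1r; apply: ler_wpM2r; first by rewrite invr_ge0.
by rewrite ger0_norm ?subr_ge0 //; rewrite -natr1 in k2; lra.
Qed.

Lemma param_net (M : R) (T : tensor R d) (L : nat) (p : param -> R) :
  (0 < L)%N -> 0 <= M -> (forall a, `|p a| <= 1) ->
  exists g : {ffun param -> 'I_(2 * L).+1}, forall i,
    `|param_tensor M T p i - param_tensor M T (fun a => grid (g a)) i| <=
      (M * (dim_prod r)%:R * m.+1%:R + linf_norm T) / L%:R.
Proof.
move=> L0 M0 p1.
have /choice[g pg] : forall a, exists k : 'I_(2 * L).+1, `|p a - grid k| <= L%:R^-1.
  by move=> a; exact: grid_approx.
exists (finfun g) => i; apply: param_tensor_lipschitz => // a; rewrite ffunE //.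
exact: grid_le1.
Qed.

Lemma card_net L : #|{ffun param -> 'I_(2 * L).+1}| =
  ((2 * L).+1 ^ (dim_prod r + \sum_j d j * r j).+1)%N.
Proof. by rewrite card_ffun card_ord card_param. Qed.

End Net.

(** * From the uniform deviation to the error bound *)

(** The cross terms are split with weights [1 / n] and [1 / (n * q)]: summed over the samples, their
    main parts cost at most [linf_norm D ^+ 2] and [sigma ^+ 2], and what is left is quadratic in
    the rounding error [dl]. *)
Lemma excess_loss_perturb (R : realType) (m n : nat) (d : 'I_m -> nat)
    (D D' : tensor R d) (x : 'I_n -> tensor R d) (z : 'I_n -> R)
    (dl sigma q S : R) :
  (0 < n)%N -> 1 <= q -> 0 <= sigma <= S ->
  (forall i, exists k, x i = basis_tensor R k) ->
  \sum_i z i ^+ 2 <= n%:R * sigma ^+ 2 * q ->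
  (forall k, `|D k - D' k| <= dl) -> 3 * n%:R ^+ 2 * q * dl ^+ 2 <= S ^+ 2 ->
  excess_loss D' x z <= excess_loss D x z + linf_norm D ^+ 2 + 2 * S ^+ 2.
Proof.
move=> n0 q1 /andP[s0 sS] xb zq DD' dlS.
have n0' : 0 < n%:R :> R by rewrite ltr0n.
have n1 : 1 <= n%:R :> R by rewrite ler1n.
have nq0 : 0 < n%:R * q by rewrite mulr_gt0 //; lra.
pose b2 := linf_norm D ^+ 2.
have term i : tensor_dot D' (x i) ^+ 2 - 2 * z i * tensor_dot D' (x i) <=
    (tensor_dot D (x i) ^+ 2 - 2 * z i * tensor_dot D (x i)) +
    (b2 / n%:R + z i ^+ 2 / (n%:R * q) + 3 * (n%:R * q) * dl ^+ 2).
  have [k ->] := xb i; rewrite !tensor_dot_basis.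
  have [e [-> e2]] : exists e, D' k = D k + e /\ e ^+ 2 <= dl ^+ 2.
    exists (D' k - D k); split; first ring.
    have := DD' k; rewrite distrC => dk.
    by rewrite -[leLHS]real_normK ?num_real // lerXn2r ?nnegrE // (le_trans _ dk).
  have Db : D k ^+ 2 <= b2.
    by rewrite -real_normK ?num_real // lerXn2r ?nnegrE ?le_linf_norm // linf_norm_ge0.
  (* AM-GM for the two cross terms of the expansion at [D k + e] *)
  have h1 : 2 * D k * e <= D k ^+ 2 / n%:R + n%:R * e ^+ 2.
    have -> : D k ^+ 2 / n%:R + n%:R * e ^+ 2 = 2 * D k * e + (D k - n%:R * e) ^+ 2 / n%:R.
      by field; rewrite gt_eqF.
    by rewrite lerDl divr_ge0 ?sqr_ge0 // ltW.
  have h2 : - (2 * z i * e) <= z i ^+ 2 / (n%:R * q) + n%:R * q * e ^+ 2.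
    have -> : z i ^+ 2 / (n%:R * q) + n%:R * q * e ^+ 2 =
        - (2 * z i * e) + (z i + n%:R * q * e) ^+ 2 / (n%:R * q).
      by field; rewrite !gt_eqF //; lra.
    by rewrite lerDl divr_ge0 ?sqr_ge0 // ltW.
  have h3 : D k ^+ 2 / n%:R <= b2 / n%:R by rewrite ler_pM2r // invr_gt0.
  have h4 : (n%:R + 1 + n%:R * q) * e ^+ 2 <= 3 * (n%:R * q) * dl ^+ 2.
    by apply: ler_pM => //; rewrite ?sqr_ge0 //; nra.
  lra.
apply: le_trans (ler_sum _ (fun i _ => term i)) _.
rewrite big_split /= -/(excess_loss D x z) -addrA lerD2l.
have -> : \sum_(i < n) (b2 / n%:R + z i ^+ 2 / (n%:R * q) + 3 * (n%:R * q) * dl ^+ 2) =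
    b2 + (\sum_i z i ^+ 2) / (n%:R * q) + 3 * n%:R ^+ 2 * q * dl ^+ 2.
  rewrite 2!big_split /= 2!sumr_const card_ord -mulr_suml.
  rewrite -[_ *+ n]mulr_natl -[X in _ + X]mulr_natl mulrC mulfVK ?gt_eqF //.
  by congr (_ + _); ring.
rewrite -[leLHS]addrA lerD2l.
have : (\sum_i z i ^+ 2) / (n%:R * q) <= sigma ^+ 2.
  by rewrite ler_pdivrMr // (le_trans zq) // le_eqVlt; apply/orP; left; apply/eqP; ring.
have : sigma ^+ 2 <= S ^+ 2 by rewrite lerXn2r ?nnegrE ?(le_trans s0 sS).
lra.
Qed.

Lemma tensor_dotB (R : realType) (m : nat) (d : 'I_m -> nat) (S T Z : tensor R d) :
  tensor_dot (S - T) Z = tensor_dot S Z - tensor_dot T Z.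
Proof. by rewrite -sumrB; apply: eq_bigr => k _; rewrite !ffunE mulrBl. Qed.

(** The truth is a feasible competitor, and the two losses differ by a positive multiple of the
    excess loss. *)
Lemma lsq_excess_loss_le0 (R : realType) (m n : nat) (d r : 'I_m -> nat) (mu : R)
    (T Z : tensor R d) (x : 'I_n -> tensor R d) (y z : 'I_n -> R) :
  (0 < dim_prod d)%N -> (0 < n)%N -> feasible r mu T ->
  (forall i, y i = tensor_dot T (x i) + z i) ->
  is_constrained_lsq r mu x y Z -> excess_loss (Z - T) x z <= 0.
Proof.
move=> d0 n0 Tf yE [_ /(_ _ Tf)].
rewrite /empirical_loss ler_pM2l; last by rewrite divr_gt0 ?ltr0n.
rewrite -subr_le0 -sumrB; apply: le_trans; rewrite le_eqVlt; apply/orP; left.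
by apply/eqP/eq_bigr => i _; rewrite yE tensor_dotB; ring.
Qed.

(** The noise part is linear in [D], while the quadratic part scales by [th ^+ 2 <= th]. *)
Lemma excess_loss_shrink (R : realType) (m n : nat) (d : 'I_m -> nat) (th : R)
    (D D' : tensor R d) (x : 'I_n -> tensor R d) (z : 'I_n -> R) :
  0 <= th <= 1 -> (forall k, D' k = th * D k) ->
  excess_loss D x z <= 0 -> excess_loss D' x z <= 0.
Proof.
move=> /andP[th0 th1] DD' Dle0.
have dotE Z : tensor_dot D' Z = th * tensor_dot D Z.
  by rewrite /tensor_dot mulr_sumr; apply: eq_bigr => k _; rewrite DD' mulrA.
apply: le_trans (_ : th * excess_loss D x z <= 0); last by nra.
rewrite /excess_loss mulr_sumr; apply: ler_sum => i _; rewrite dotE.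
rewrite -subr_ge0 [leRHS](_ : _ = th * (1 - th) * tensor_dot D (x i) ^+ 2); last by ring.
by rewrite mulr_ge0 ?sqr_ge0 // mulr_ge0 // subr_ge0.
Qed.

(** The arithmetic of the error bound. [x2] and [b2] are the squared Frobenius and sup norms of the
    error, [y2] and [b2'] those of its rounding, and [dl2] is the squared rounding error per
    entry. *)
Lemma excess_loss_lower_bound (R : realType) (x2 y2 b2 b2' S sigma kap H N t c dl2 : R) :
  0 <= x2 -> 0 < H -> 0 < N -> 0 < c -> 0 <= sigma <= S -> 1 <= kap -> 1 <= t ->
  x2 <= 2 * y2 + 2 * (H * dl2) -> b2' <= 2 * b2 + 2 * dl2 ->
  b2 <= 4 * kap * x2 / H + 6 * kap * S ^+ 2 -> 0 <= b2 ->
  N * dl2 <= S ^+ 2 -> dl2 <= S ^+ 2 ->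
  N * y2 / (4 * H) - t * (16 * sigma ^+ 2 / c + b2') <= b2 + 2 * S ^+ 2 ->
  192 * t * kap <= N ->
  x2 <= 16 * t * kap / N * (16 / c + 23) * (S ^+ 2 * H).
Proof.
move=> x0 H0 N0 c0 /andP[s0 sS] k1 t1 xy bb' bx b0 Nd dS dev Nk.
have S20 : 0 <= S ^+ 2 := sqr_ge0 S.
have sS2 : sigma ^+ 2 <= S ^+ 2 by rewrite lerXn2r ?nnegrE ?(le_trans s0 sS).
have scS : 16 * sigma ^+ 2 / c <= 16 / c * S ^+ 2.
  by rewrite mulrAC ler_wpM2l // divr_ge0 // ltW.
set a := 16 / c in scS *.
have a0 : 0 <= a by rewrite divr_ge0 // ltW.
set u := x2 / H.
have xE : x2 = u * H by rewrite /u mulfVK // gt_eqF.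
set v := y2 / H.
have yE : y2 = v * H by rewrite /v mulfVK // gt_eqF.
have uv : u <= 2 * v + 2 * dl2.
  rewrite -(ler_pM2r H0) -xE (le_trans xy) // yE; lra.
have bu : b2 <= 4 * kap * u + 6 * kap * S ^+ 2 by rewrite /u mulrA.
have devv : N * v / 4 <= b2 + 2 * S ^+ 2 + t * (a * S ^+ 2 + b2').
  have -> : N * v / 4 = N * y2 / (4 * H) by rewrite yE; field; rewrite gt_eqF.
  have : t * (16 * sigma ^+ 2 / c + b2') <= t * (a * S ^+ 2 + b2').
    by rewrite ler_pM2l ?lerD2r //; lra.
  lra.
have u0 : 0 <= u by rewrite divr_ge0 // ltW.
have tk1 : 1 <= t * kap by rewrite mulr_ege1.
have b2t : b2 <= t * b2 by rewrite ler_peMl.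
have St : S ^+ 2 <= t * S ^+ 2 by rewrite ler_peMl.
have tb' : t * b2' <= t * (2 * b2 + 2 * S ^+ 2) by rewrite ler_pM2l; lra.
have tb : t * b2 <= t * (4 * kap * u + 6 * kap * S ^+ 2) by rewrite ler_pM2l //; lra.
have tk : t <= t * kap by nra.
have tkS : t * S ^+ 2 <= t * kap * S ^+ 2 by exact: ler_wpM2r.
have tkaS : t * (a * S ^+ 2) <= t * kap * (a * S ^+ 2).
  by apply: ler_wpM2r; first exact: mulr_ge0.
have Nu : N * u <= N * (2 * v + 2 * dl2) by rewrite ler_pM2l.
(* The sup norms contribute at most [24 * t * b2] to [N * u], whose part in [u] is
   [96 * t * kap * u], absorbed by half of [N * u]. The rest leaves [356 + 16 * a] times
   [t * kap * S ^+ 2], and [356 <= 16 * 23]. *)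
have tku : 192 * (t * kap) * u <= N * u by rewrite ler_wpM2r // mulrA.
rewrite xE (mulrA _ (S ^+ 2)) ler_pM2r //.
rewrite [leRHS](_ : _ = 16 * (t * kap) * ((a + 23) * S ^+ 2) / N); last first.
  by field; rewrite gt_eqF.
rewrite ler_pdivlMr // mulrC.
lra.
Qed.

(** The deterministic part, for an outcome where the bounds of [uniform_deviation] hold. The
    shrunken error [De] is rounded to the grid and bounded first; afterwards the shrinking factor is
    shown to be 1. *)
Lemma lsq_error_bound (R : realType) (m n L : nat) (d r : 'I_m -> nat)
    (mu sigma S c t q : R) (T Z : tensor R d)
    (x : 'I_n -> tensor R d) (z : 'I_n -> R) :
  let H : R := (dim_prod d)%:R in
  let kap := mu ^+ m * (dim_prod r)%:R in
  let M := 3 * Num.sqrt H * S in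
  (0 < dim_prod d)%N -> (0 < n)%N -> (0 < L)%N -> (forall j, 0 < r j)%N ->
  0 < c -> 0 <= sigma <= S -> 0 < S -> 1 <= kap -> 1 <= t -> 1 <= q ->
  linf_norm T <= S -> feasible r mu Z ->
  excess_loss (Z - T) x z <= 0 ->
  (forall i, exists k, x i = basis_tensor R k) ->
  \sum_i z i ^+ 2 <= n%:R * sigma ^+ 2 * q ->
  (forall g : {ffun param d r -> 'I_(2 * L).+1},
    let F := param_tensor M T (fun a => grid R (g a)) in
    n%:R * sqnorm F / (4 * H) - t * (16 * sigma ^+ 2 / c + linf_norm F ^+ 2) <=
      excess_loss F x z) ->
  3 * n%:R ^+ 2 * q * ((M * (dim_prod r)%:R * m.+1%:R + S) / L%:R) ^+ 2 <= S ^+ 2 ->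
  192 * t * kap <= n%:R ->
  16 * t * kap * (16 / c + 23) <= n%:R ->
  sqnorm (Z - T) <= 16 * t * kap / n%:R * (16 / c + 23) * (S ^+ 2 * H).
Proof.
move=> H kap M d0 n0 L0 r0 c0 sS S0 k1 t1 q1 TS [D [W [ZE WI]]] Qle0 xb zq net small nk1 nk2.
have H0 : 0 < H by rewrite ltr0n.
have N0 : 0 < n%:R :> R by rewrite ltr0n.
have N1 : 1 <= n%:R :> R by rewrite ler1n.
have sH0 : 0 < Num.sqrt H by rewrite sqrtr_gt0.
have M0 : 0 < M by rewrite !mulr_gt0.
have M2 : M ^+ 2 = 9 * H * S ^+ 2 by rewrite /M !exprMn sqr_sqrtr ?(ltW H0) //; ring.
have Wo j : orthonormal_cols (W j) by have [] := WI j.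
have TsqS k : T k ^+ 2 <= S ^+ 2.
  rewrite -real_normK ?num_real // lerXn2r ?nnegrE ?(ltW S0) //.
  exact: le_trans (le_linf_norm _ _) TS.
have TsqH : sqnorm T <= H * S ^+ 2 by exact: sqnorm_le.
pose nZ := Num.sqrt (sqnorm Z).
have nZ2 : nZ ^+ 2 = sqnorm Z by rewrite sqr_sqrtr // sqnorm_ge0.
pose th := if nZ <= M then 1 else M / nZ.
have th01 : 0 <= th <= 1.
  rewrite /th; case: (leP nZ M) => [_|MZ]; first by rewrite ler01 lexx.
  have nZ0 := lt_trans M0 MZ.
  by rewrite divr_ge0 ?(ltW M0) ?(ltW nZ0) //= ler_pdivrMr // mul1r ltW.
have thM : th * nZ <= M.
  rewrite /th; case: (leP nZ M) => [h|MZ]; first by rewrite mul1r.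
  by rewrite mulfVK // gt_eqF // (lt_trans M0 MZ).
have [th0 th1] := andP th01.
pose Z' : tensor R d := [ffun k => th * Z k].
pose T' : tensor R d := [ffun k => th * T k].
pose De : tensor R d := Z' - T'.
have DeE k : De k = th * (Z - T) k by rewrite !ffunE; ring.
have DQ : excess_loss De x z <= 0 by exact: (excess_loss_shrink th01 DeE Qle0).
have T'sq k : T' k ^+ 2 <= S ^+ 2.
  rewrite ffunE exprMn -[leRHS]mul1r; apply: ler_pM; rewrite ?sqr_ge0 //.
  by rewrite expr_le1.
have T'sqH : sqnorm T' <= H * S ^+ 2 by exact: sqnorm_le.
have Z'sq : sqnorm Z' = (th * nZ) ^+ 2.
  by rewrite exprMn nZ2 /sqnorm mulr_sumr; apply: eq_bigr => k _; rewrite ffunE exprMn.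
have Z'le := sqnorm_leD Z' T'; rewrite -/De in Z'le.
pose dl := (M * (dim_prod r)%:R * m.+1%:R + S) / L%:R.
(* Parameters of [De]: the shrunken core divided by [M], the factors of [Z], and the weight [th] for
   [T]. *)
pose p (a : param d r) : R := match a with
  | None => th
  | Some (inl k) => th * D k / M
  | Some (inr (existT j ab)) => W j ab.1 ab.2
  end.
have p1 a : `|p a| <= 1.
  case: a => [[k|[j [a b]]]|] /=; last by rewrite ger0_norm.
    rewrite normrM [X in _ * X]ger0_norm ?invr_ge0 ?(ltW M0) // ler_pdivrMr // mul1r.
    apply: le_trans thM; rewrite normrM ger0_norm //; apply: ler_wpM2l => //.
    rewrite -(@ler_pXn2r _ 2) ?nnegrE ?sqrtr_ge0 // nZ2 ZE sqnorm_multilinear //.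
    rewrite real_normK ?num_real // /sqnorm (bigD1 k) //= lerDl.
    by apply: sumr_ge0 => l _; exact: sqr_ge0.
  exact: orthonormal_cols_entry.
have [g pg] := param_net T L0 (ltW M0) p1.
set F := param_tensor M T (fun a => grid R (g a)) in pg.
have pE : param_tensor M T p = De.
  apply/ffunP => i; rewrite DeE !ffunE ZE ffunE mulrBr; congr (_ - _).
  rewrite !mulr_sumr; apply: eq_bigr => k _; rewrite ffunE.
  rewrite !mulrA [M * th]mulrC; congr (_ * _).
    by rewrite -/M /=; field; rewrite gt_eqF.
  by apply: eq_bigr => j _; rewrite mxE.
have DF k : `|De k - F k| <= dl.
  rewrite -pE; apply: le_trans (pg k) _; rewrite /dl ler_pM2r ?invr_gt0 ?ltr0n //.
  by rewrite lerD2l.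
have dl0 : 0 <= dl.
  by rewrite divr_ge0 // addr_ge0 ?(ltW S0) // mulr_ge0 // mulr_ge0 // ltW.
have DFsq k : (De k - F k) ^+ 2 <= dl ^+ 2.
  by rewrite -real_normK ?num_real // lerXn2r ?nnegrE.
have S20 : 0 <= S ^+ 2 := sqr_ge0 S.
have d20 : 0 <= dl ^+ 2 := sqr_ge0 dl.
have Q1 := excess_loss_perturb n0 q1 sS xb zq DF small.
have Q2 := net g; rewrite -/F /= in Q2.
have Ndl : n%:R * dl ^+ 2 <= S ^+ 2.
  apply: le_trans small; rewrite -/dl; apply: ler_wpM2r => //.
  have -> : 3 * n%:R ^+ 2 * q = n%:R * (3 * (n%:R * q)) by ring.
  by rewrite ler_peMr ?ler0n //; have := mulr_ege1 N1 q1; lra.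
have dlS : dl ^+ 2 <= S ^+ 2.
  by apply: le_trans Ndl; rewrite ler_peMl.
have De_le_F : sqnorm De <= 2 * sqnorm F + 2 * (H * dl ^+ 2).
  apply: le_trans (sqnorm_leD De F) _; rewrite addrC lerD2l ler_pM2l //.
  by apply: sqnorm_le => k; have := DFsq k; rewrite !ffunE.
have F_le_De : linf_norm F ^+ 2 <= 2 * linf_norm De ^+ 2 + 2 * dl ^+ 2.
  apply: linf_norm_sqr_le => [|k]; first by rewrite addr_ge0 // mulr_ge0 // sqr_ge0.
  have h1 : De k ^+ 2 <= linf_norm De ^+ 2.
    by rewrite -real_normK ?num_real // lerXn2r ?nnegrE ?le_linf_norm // linf_norm_ge0.
  have h2 := DFsq k; have := sqr_ge0 (2 * De k - F k); nra.
(* Incoherence bounds the entries of [Z'] through its Frobenius norm, which is compared with that of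
   [De]; the entries of [T'] are at most [S] directly. *)
have De_linf : linf_norm De ^+ 2 <= 4 * kap * sqnorm De / H + 6 * kap * S ^+ 2.
  have De0 := sqnorm_ge0 De.
  have k0 : 0 <= kap by lra.
  apply: linf_norm_sqr_le => [|k].
    apply: addr_ge0; last by rewrite mulr_ge0 // mulr_ge0.
    by rewrite divr_ge0 ?(ltW H0) // mulr_ge0 // mulr_ge0.
  have Zk : Z' k ^+ 2 <= kap / H * sqnorm Z'.
    rewrite ffunE exprMn Z'sq exprMn nZ2 [leRHS]mulrCA; apply: ler_wpM2l; first exact: sqr_ge0.
    by rewrite ZE /kap /H; exact: incoherent_entry_sqr.
  have kZ' : kap / H * sqnorm Z' <= kap / H * (2 * sqnorm De + 2 * (H * S ^+ 2)).
    apply: ler_wpM2l; first by rewrite divr_ge0 // ltW.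
    by rewrite (le_trans Z'le) // lerD2l ler_pM2l.
  have kE : kap / H * (2 * sqnorm De + 2 * (H * S ^+ 2)) =
      2 * (kap * sqnorm De / H) + 2 * kap * S ^+ 2 by field; rewrite gt_eqF.
  have h : De k ^+ 2 <= 2 * Z' k ^+ 2 + 2 * T' k ^+ 2.
    have -> : De k = Z' k - T' k by rewrite /De !ffunE.
    by have := sqr_ge0 (Z' k + T' k); nra.
  have kS : S ^+ 2 <= kap * S ^+ 2 by rewrite ler_peMl.
  have -> : 4 * kap * sqnorm De / H = 4 * (kap * sqnorm De / H) by rewrite -!mulrA.
  have -> : 6 * kap * S ^+ 2 = 6 * (kap * S ^+ 2) by rewrite mulrA.
  rewrite -[2 * kap * _]mulrA in kE.
  by have := T'sq k; lra.
have De_bound : sqnorm De <= 16 * t * kap / n%:R * (16 / c + 23) * (S ^+ 2 * H).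
  apply: (@excess_loss_lower_bound R _ (sqnorm F) (linf_norm De ^+ 2) (linf_norm F ^+ 2)
    S sigma kap H n%:R t c (dl ^+ 2)) => //.
  - exact: sqnorm_ge0.
  - exact: sqr_ge0.
  - by rewrite (le_trans Q2) // (le_trans Q1) // lerD2r gerDr.
suff th1' : th = 1.
  apply: le_trans De_bound; rewrite /sqnorm le_eqVlt; apply/orP; left; apply/eqP.
  by apply: eq_bigr => k _; rewrite DeE th1' mul1r.
have SH0 : 0 < S ^+ 2 * H by rewrite mulr_gt0 // exprn_gt0.
have De_SH : sqnorm De <= S ^+ 2 * H.
  apply: le_trans De_bound _; rewrite -[leRHS]mul1r ler_pM2r // mulrAC.
  by rewrite ler_pdivrMr // mul1r.
apply/eqP; rewrite -[_ == _]negbK; apply/negP => thN1.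
have MZ : M < nZ.
  by move: thN1; rewrite /th; case: (leP nZ M) => //; rewrite eqxx.
have thnZ : th * nZ = M.
  by rewrite /th leNgt MZ /= mulfVK // gt_eqF // (lt_trans M0 MZ).
(* If [th < 1], then [Z'] has squared norm exactly [9 * H * S ^+ 2], yet it is at most
   [4 * H * S ^+ 2]. This is the reason for the factor 3 in [M]. *)
by rewrite Z'sq thnZ M2 in Z'le; lra.
Qed.

(** * Rounding error and cardinality of the grid *)

Section Dimensions.
Variables (R : realType) (m : nat) (d r : 'I_m -> nat).
Hypotheses (m0 : (0 < m)%N) (r0 : forall j, (0 < r j)%N).
Hypothesis rd : forall j, (r j <= d j)%N.
Hypothesis m_small : (8 * m <= dim_max d)%N.

Let D := dim_max d.

Lemma dim_max_ge8 : (8 <= dim_max d)%N.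
Proof. by apply: leq_trans m_small; exact: leq_pmulr. Qed.

Let D1 : (1 <= D)%N. Proof. exact: leq_trans dim_max_ge8. Qed.

Lemma le_dim_max (e : 'I_m -> nat) j : (e j <= dim_max e)%N.
Proof. exact: leq_bigmax. Qed.

Lemma dim_prod_gt0 (e : 'I_m -> nat) : (forall j, 0 < e j)%N -> (0 < dim_prod e)%N.
Proof. by move=> e0; apply: prodn_gt0. Qed.

Lemma dim_prod_le_expn : (dim_prod d <= D ^ m)%N.
Proof.
rewrite -[X in (_ <= _ ^ X)%N]card_ord -prod_nat_const; apply: leq_prod => j _.
exact: le_dim_max.
Qed.

Lemma dim_prod_le : (dim_prod r <= dim_prod d)%N.
Proof. by apply: leq_prod => j _. Qed.

(** The numerator is at most [S * D ^+ (3 * m)], so the powers of [D] above the line add up to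
    [8 m + 3 m + 6 m = 17 m]. The mesh contributes [18 m] below it, and the spare [D ^+ m >= 8]
    absorbs the factor 3. *)
Lemma net_resolution (n : nat) (S : R) : (n <= D ^ (4 * m))%N -> 0 < S ->
  3 * n%:R ^+ 2 * D%:R ^+ (3 * m) *
    ((3 * Num.sqrt (dim_prod d)%:R * S * (dim_prod r)%:R * m.+1%:R + S)
       / (D ^ (9 * m))%:R) ^+ 2 <= S ^+ 2.
Proof.
move=> nD S0.
have D0' : 0 < D%:R :> R by rewrite ltr0n.
have H1 : 1 <= (dim_prod d)%:R :> R.
  rewrite ler1n dim_prod_gt0 // => j; exact: leq_trans (rd j).
have num : 3 * Num.sqrt (dim_prod d)%:R * S * (dim_prod r)%:R * m.+1%:R + S <=
    S * D%:R ^+ (3 * m).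
  have sH : Num.sqrt (dim_prod d)%:R <= (dim_prod d)%:R :> R.
    rewrite -(@ler_pXn2r _ 2) ?nnegrE ?sqrtr_ge0 // sqr_sqrtr //.
    by rewrite expr2 ler_peMl.
  have h : 3 * Num.sqrt (dim_prod d)%:R * S * (dim_prod r)%:R * m.+1%:R <=
      S * ((dim_prod d)%:R ^+ 2 * (3 * m.+1%:R)).
    rewrite [leLHS](_ : _ = S * (Num.sqrt (dim_prod d)%:R * (dim_prod r)%:R * (3 * m.+1%:R))); last by ring.
    rewrite ler_pM2l // ler_wpM2r // expr2; apply: ler_pM => //.
    by rewrite ler_nat dim_prod_le.
  apply: (@le_trans _ _ (S * ((dim_prod d)%:R ^+ 2 * (3 * m + 4)%:R))).
    rewrite natrD natrM -natr1 in h *.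
    have : 1 <= (dim_prod d)%:R ^+ 2 :> R by rewrite exprn_ege1.
    by have := ltW S0; nra.
  rewrite ler_pM2l // -!natrX -natrM ler_nat.
  apply: leq_trans (_ : (D ^ m) ^ 2 * D ^ m <= _)%N; last first.
    by rewrite -expnM -expnD leq_pexp2l //; lia.
  apply: leq_mul; first by rewrite leq_exp2r // dim_prod_le_expn.
  apply: (@leq_trans D); last by rewrite -[leqLHS]expn1 leq_pexp2l.
  by apply: leq_trans m_small; lia.
rewrite expr_div_n mulrA ler_pdivrMr ?exprn_gt0 ?ltr0n ?expn_gt0 ?D1 //.
apply: (@le_trans _ _ (3 * (D%:R ^+ (4 * m)) ^+ 2 * D%:R ^+ (3 * m) * (S * D%:R ^+ (3 * m)) ^+ 2)).
  apply: ler_pM; rewrite ?sqr_ge0 ?mulr_ge0 ?exprn_ge0 //.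
    rewrite ler_pM2r ?exprn_gt0 // ler_pM2l // lerXn2r ?nnegrE ?exprn_ge0 //.
    by rewrite -natrX ler_nat.
  rewrite lerXn2r ?nnegrE ?mulr_ge0 ?exprn_ge0 ?addr_ge0 ?mulr_ge0 ?sqrtr_ge0 ?(ltW S0) //.
rewrite exprMn natrX [leLHS](_ : _ = S ^+ 2 * (3 * D%:R ^+ (17 * m))); last first.
  rewrite -!exprM (_ : 17 * m = 4 * m * 2 + 3 * m + 3 * m * 2)%N; last by lia.
  by rewrite 2!exprD; ring.
rewrite ler_pM2l ?exprn_gt0 // -exprM (_ : 9 * m * 2 = m + 17 * m)%N; last by lia.
rewrite exprD ler_pM2r ?exprn_gt0 //.
rewrite -natrX ler_nat; apply: (@leq_trans D); last by rewrite -[leqLHS]expn1 leq_pexp2l.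
exact: leq_trans dim_max_ge8.
Qed.

Lemma expR_natM_ln k : expR (k%:R * ln D%:R) = D%:R ^+ k :> R.
Proof. by rewrite expRM_natl lnK // posrE ltr0n. Qed.

(** Each parameter takes at most [D ^ (10 * m)] values, and their number is linear in
    [m * D * dim_max r]. *)
Lemma card_net_le (K : R) :
  (forall j, (dim_prod r)%:R / (r j)%:R <= K * (d j)%:R) -> 0 < K ->
  #|{ffun param d r -> 'I_(2 * D ^ (9 * m)).+1}|%:R <=
    expR (10 * (K + 2) * (m%:R ^+ 2 * (dim_max r)%:R * D%:R * ln D%:R)) :> R.
Proof.
move=> rK K0; rewrite card_net natrX.
have l0 : 0 <= ln D%:R :> R by rewrite ln_ge0 // ler1n.
set k := (_ + _).+1.
(* In [K + 2], the [K] pays for the core, via the bound on [dim_prod r / r j], and the two units for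
   the factors and for the weight of [T]. *)
have kle : k%:R <= (K + 2) * m%:R * D%:R * (dim_max r)%:R :> R.
  pose j0 := Ordinal m0.
  have m1 : 1 <= m%:R :> R by rewrite ler1n.
  have D1' : 1 <= D%:R :> R by rewrite ler1n.
  have rb1 : 1 <= (dim_max r)%:R :> R.
    by rewrite ler1n; exact: leq_trans (r0 j0) (le_dim_max r j0).
  have Drb : 1 <= D%:R * (dim_max r)%:R :> R by rewrite mulr_ege1.
  have mDr : D%:R * (dim_max r)%:R <= m%:R * (D%:R * (dim_max r)%:R) :> R.
    by rewrite ler_peMl // mulr_ge0.
  have h1 : (dim_prod r)%:R <= K * (D%:R * (dim_max r)%:R) :> R.
    have := rK j0; rewrite ler_pdivrMr ?ltr0n // => /le_trans; apply.
    rewrite -mulrA ler_pM2l //; apply: ler_pM => //; rewrite ler_nat; exact: le_dim_max.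
  have h2 : (\sum_j d j * r j)%N%:R <= m%:R * (D%:R * (dim_max r)%:R) :> R.
    rewrite -!natrM ler_nat -[X in (_ <= X * _)%N]card_ord -sum_nat_const.
    by apply: leq_sum => j _; apply: leq_mul; exact: le_dim_max.
  have h3 : K * (D%:R * (dim_max r)%:R) <= K * (m%:R * (D%:R * (dim_max r)%:R)).
    by rewrite ler_pM2l.
  rewrite /k -natr1 natrD; lra.
have base : (2 * D ^ (9 * m)).+1%:R <= expR ((10 * m)%:R * ln D%:R) :> R.
  rewrite expR_natM_ln -natrX ler_nat.
  apply: (@leq_trans (3 * D ^ (9 * m))).
    by rewrite -addn1 (mulnDl 2 1) mul1n leq_add2l expn_gt0 D1.
  rewrite (_ : 10 * m = m + 9 * m)%N; last by lia.
  rewrite expnD leq_mul2r; apply/orP; right.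
  apply: (@leq_trans D); last by rewrite -[leqLHS]expn1 leq_pexp2l.
  exact: leq_trans dim_max_ge8.
apply: (@le_trans _ _ (expR ((10 * m)%:R * ln D%:R) ^+ k)).
  by rewrite lerXn2r ?nnegrE ?expR_ge0.
rewrite -expRM_natl ler_expR natrM.
have -> : 10 * (K + 2) * (m%:R ^+ 2 * (dim_max r)%:R * D%:R * ln D%:R) =
   ((K + 2) * m%:R * D%:R * (dim_max r)%:R) * (10 * m%:R * ln D%:R) :> R by ring.
by rewrite ler_wpM2r // mulr_ge0 // mulr_ge0.
Qed.

End Dimensions.

Lemma incoherence_bounds (R : realType) (p q : nat) (W : 'M[R]_(p, q)) (mu : R) :
  (0 < q)%N -> orthonormal_cols W ->
  norm2inf W <= Num.sqrt (mu * q%:R / p%:R) -> 1 <= mu /\ Inco W <= mu.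
Proof.
move=> q0 Wo Wmu.
have p0 : (0 < p)%N := leq_trans q0 (orthonormal_cols_dim Wo).
have q0' : 0 < q%:R :> R by rewrite ltr0n.
have p0' : 0 < p%:R :> R by rewrite ltr0n.
have qW := orthonormal_cols_norm2inf Wo.
have W0 : 0 < norm2inf W ^+ 2.
  by rewrite -(pmulr_rgt0 _ p0'); exact: lt_le_trans qW.
(* The square root of a nonpositive number is 0, so a nonzero row norm forces a positive
   radicand. *)
have s0 : 0 < mu * q%:R / p%:R.
  rewrite -sqrtr_gt0; apply: lt_le_trans Wmu.
  by rewrite lt_def norm2inf_ge0 andbT; apply: contraTneq W0 => ->; rewrite expr0n ltxx.
have W2 : norm2inf W ^+ 2 <= mu * q%:R / p%:R.
  by rewrite -[leRHS]sqr_sqrtr ?(ltW s0) // lerXn2r ?nnegrE ?norm2inf_ge0 ?sqrtr_ge0.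
split; last by rewrite Inco_norm2inf.
rewrite -(ler_pM2r q0') mul1r (le_trans qW) //.
rewrite [leRHS](_ : _ = p%:R * (mu * q%:R / p%:R)); last by field; rewrite gt_eqF.
by rewrite ler_pM2l.
Qed.

(** * Choice of the constants and conclusion *)

Theorem theorem8 (R : realType) (c K : R) (c_gt0 : 0 < c) (K_gt0 : 0 < K) :
  exists c0 Cgap C : R, [/\ 0 < c0, 0 < Cgap, 0 < C &
  forall (m : nat) (d r : 'I_m -> nat) (n : nat) (mu sigma : R)
    (disp : measure_display) (Omega : measurableType disp)
    (P : probability Omega R)
    (T : tensor R d) (core : tensor R r) (U : forall j, 'M[R]_(d j, r j))
    (X : 'I_n -> Omega -> tensor R d) (xi : 'I_n -> {RV P >-> R})
    (Y : 'I_n -> Omega -> R),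
  (0 < m)%N ->
  (forall j, 0 < r j)%N ->
  has_multilinear_rank T r ->
  T = multilinear_prod core U ->
  (forall j, orthonormal_cols (U j)) ->
  (forall j, norm2inf (U j) <= Num.sqrt (mu * (r j)%:R / (d j)%:R)) ->
  0 < sigma ->
  (forall i, random_tensor (X i)) ->
  (forall i, uniform_on_basis P (X i)) ->
  identically_distributed P xi ->
  design_noise_independent P X xi ->
  (forall i, ('E_P[xi i] = 0)%E) ->
  (forall i, ('E_P[(fun w => xi i w ^+ 2)%R] = (sigma ^+ 2)%:E)%E) ->
  (forall i,
     ('E_P[(fun w => expR (c * xi i w ^+ 2 / sigma ^+ 2))%R] <= 2%:E)%E) ->
  (forall i w, Y i w = tensor_dot T (X i w) + xi i w) ->
  (n <= dim_max d ^ (4 * m))%N ->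
  m%:R <= c0 * (dim_max d)%:R ->
  (forall j, (dim_prod r)%:R / (r j)%:R <= K * (d j)%:R) ->
  n%:R >= Cgap * mu ^+ m * m%:R ^+ 2 * (dim_max r)%:R * (dim_prod r)%:R
            * (dim_max d)%:R * ln (dim_max d)%:R ->
  exists E : set Omega,
    [/\ measurable E,
        (P E >= (1 - 6 * (dim_max d)%:R ^- (3 * m))%:E)%E &
        forall w, E w -> forall That : tensor R d,
          is_constrained_lsq r mu (fun i => X i w) (fun i => Y i w) That ->
          frobenius (That - T) <=
            C * Num.max sigma (linf_norm T)
              * Num.sqrt (mu ^+ (2 * m) * m%:R ^+ 2 * (dim_max r)%:R
                          * (dim_prod r)%:R ^+ 2 * (dim_prod d)%:R
                          * (dim_max d)%:R * ln (dim_max d)%:R / n%:R)]].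
Proof.
(* The first summand pays for the logarithm of the grid size, the 3 for the failure probability
   [D ^- (3 * m)]. *)
pose Ct : R := 10 * (K + 2) + 3.
pose C3 : R := 16 * Ct * (16 / c + 23).
have Ct0 : 23 <= Ct by rewrite /Ct; lra.
have c16 : 0 < 16 / c by rewrite divr_gt0.
have C30 : 0 < C3 by rewrite /C3 !mulr_gt0 //; lra.
have C31 : 0 <= 1 + C3 by lra.
have C3_sqr : C3 <= (1 + C3) ^+ 2 by nra.
(* [8^-1] yields [8 * m <= dim_max d], the second constant covers both sample size conditions of
   [lsq_error_bound], and [(1 + C3) ^+ 2 >= C3] avoids a root. *)
exists 8^-1, (192 * Ct + C3), (1 + C3); split; [by rewrite invr_gt0|lra|lra|].
move=> m d r n mu sigma disp Omega P T core U X xi Y m0 r0 _ TE Uo Umu s0 Xr Xu _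
  ind mean var psi2 YE nD mD rK gap.
have rd j : (r j <= d j)%N by exact: orthonormal_cols_dim (Uo j).
have d0 j : (0 < d j)%N := leq_trans (r0 j) (rd j).
have [mu1 _] := incoherence_bounds (r0 (Ordinal m0)) (Uo _) (Umu _).
have Tf : feasible r mu T.
  by exists core, U; split=> // j; have [] := incoherence_bounds (r0 j) (Uo j) (Umu j).
have m_small : (8 * m <= dim_max d)%N.
  by rewrite -(@ler_nat R) natrM; move: mD; lra.
have D8 : (8 <= dim_max d)%N := dim_max_ge8 m0 m_small.
have H0 := dim_prod_gt0 d0.
set D : R := (dim_max d)%:R in nD mD gap *.
have D8' : 8 <= D by rewrite ler_nat.
have D0 : 0 < D by lra.
have D1 : 1 <= D by lra.
have ln1 : 7 / 8 <= ln D.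
  have := @le_ln1Dx R (D^-1 - 1); rewrite [1 + _]addrC subrK lnV ?posrE //.
  have : D^-1 <= 8^-1 by rewrite lef_pV2 ?posrE.
  have : 0 < D^-1 by rewrite invr_gt0.
  lra.
set rb : R := (dim_max r)%:R in gap *.
set rp : R := (dim_prod r)%:R in gap *.
pose kap := mu ^+ m * rp.
pose N1 := m%:R ^+ 2 * rb * D * ln D.
have m1 : 1 <= m%:R :> R by rewrite ler1n.
have rb1 : 1 <= rb.
  by rewrite ler1n; exact: leq_trans (r0 (Ordinal m0)) (le_dim_max r _).
have rp1 : 1 <= rp by rewrite ler1n dim_prod_gt0.
have k1 : 1 <= kap by rewrite mulr_ege1 // exprn_ege1.
have N1m : m%:R * ln D <= N1.
  rewrite /N1 ler_wpM2r //; first lra.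
  rewrite expr2 -!mulrA ler_peMr ?ler0n // mulr_ege1 // mulr_ege1 //; lra.
have N1_ge : 7 / 8 <= N1 by apply: le_trans N1m; nra.
have N1_gt0 : 0 < N1 by lra.
have gap' : (192 * Ct + C3) * (kap * N1) <= n%:R.
  by apply: le_trans gap; rewrite /kap /N1 le_eqVlt; apply/orP; left; apply/eqP; ring.
have kap0 : 0 < kap := lt_le_trans ltr01 k1.
have kN : 0 < kap * N1 by exact: mulr_gt0.
have CkN : 0 < C3 * (kap * N1) by exact: mulr_gt0.
have n0 : (0 < n)%N.
  rewrite -(@ltr0n R); apply: lt_le_trans gap'.
  by rewrite mulr_gt0 // addr_gt0 // mulr_gt0 // (lt_le_trans _ Ct0).
have n0' : 0 < n%:R :> R by rewrite ltr0n.
pose S := Num.max sigma (linf_norm T).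
have sS : 0 <= sigma <= S by rewrite (ltW s0) le_max lexx.
have S0 : 0 < S by rewrite lt_max s0.
have TS : linf_norm T <= S by rewrite le_max lexx orbT.
pose L := (dim_max d ^ (9 * m))%N.
have L0 : (0 < L)%N by rewrite expn_gt0 (leq_trans _ D8).
pose H : R := (dim_prod d)%:R.
have H0' : 0 < H by rewrite ltr0n.
pose M := 3 * Num.sqrt H * S.
(* With this [q] the noise energy and the grid each fail with probability at most [D ^- (3 * m)]. *)
pose q := D ^+ (3 * m).
have q1 : 1 <= q by rewrite exprn_ege1.
pose t := Ct * N1.
have t1 : 1 <= t.
  by apply: le_trans (ler_pM _ _ Ct0 N1_ge) => //; rewrite mulrA ler_pdivlMr // -natrM mul1r ler_nat.
have [E [mE PE EP]] := @uniform_deviation _ _ _ P m n d X xi Xr Xu ind c sigma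
  c_gt0 s0 mean var psi2 {ffun param d r -> 'I_(2 * L).+1}
  (fun g => param_tensor M T (fun a => grid R (g a))) t q H0 n0 (lt_le_trans ltr01 q1).
exists E; split=> //.
  apply: le_trans PE; rewrite lee_fin lerD2l lerN2.
  have netle : #|{ffun param d r -> 'I_(2 * L).+1}|%:R * expR (- t) <= q^-1.
    apply: (@le_trans _ _ (expR (10 * (K + 2) * N1) * expR (- t))).
      by rewrite ler_wpM2r ?expR_ge0 //; exact: card_net_le.
    rewrite -expRD.
    have -> : q^-1 = expR (- ((3 * m)%:R * ln D)) by rewrite expRN expR_natM_ln.
    rewrite ler_expR -lerBrDr opprK /t natrM -mulrA.
    by move: N1m; clear; rewrite /Ct => N1m; lra.
  have q0 : 0 < q^-1 by rewrite invr_gt0 exprn_gt0.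
  by move: netle q0; rewrite -/q; clear; move=> netle q0; lra.
move=> w Ew That That_lsq; have [wX wxi wnet] := EP w Ew.
have Qle0 := lsq_excess_loss_le0 H0 n0 Tf (fun i => YE i w) That_lsq.
have [That_f _] := That_lsq.
have small := net_resolution m0 r0 rd m_small nD S0.
have b1 : 192 * t * kap <= n%:R.
  apply: le_trans gap'; rewrite [leRHS]mulrDl [leLHS](_ : _ = 192 * Ct * (kap * N1)); last first.
    by rewrite /t; ring.
  by rewrite lerDl ltW.
have b2 : 16 * t * kap * (16 / c + 23) <= n%:R.
  apply: le_trans gap'; rewrite [leRHS]mulrDl [leLHS](_ : _ = C3 * (kap * N1)); last first.
    by rewrite /t /C3; ring.
  rewrite lerDr; apply: mulr_ge0; last exact: ltW.
  by rewrite mulr_ge0 // (le_trans _ Ct0).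
have err := lsq_error_bound H0 n0 L0 r0 c_gt0 sS S0 k1 t1 q1 TS That_f Qle0 wX wxi wnet small b1 b2.
(* The bound obtained is linear in [kap]; since [1 <= kap], it is relaxed to [kap ^+ 2], which
   supplies the powers [mu ^+ (2 * m)] and [rp ^+ 2]. *)
have target : 16 * t * kap / n%:R * (16 / c + 23) * (S ^+ 2 * H) <=
    ((1 + C3) * S) ^+ 2 * (mu ^+ (2 * m) * m%:R ^+ 2 * rb * rp ^+ 2 * H * D * ln D / n%:R).
  have -> : mu ^+ (2 * m) * m%:R ^+ 2 * rb * rp ^+ 2 * H * D * ln D / n%:R =
      kap ^+ 2 * (N1 * H / n%:R).
    by rewrite /kap /N1 mulnC exprM; field; rewrite gt_eqF.
  have -> : 16 * t * kap / n%:R * (16 / c + 23) * (S ^+ 2 * H) =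
      C3 * kap * (S ^+ 2 * (N1 * H / n%:R)).
    by rewrite /t /C3; field; rewrite !gt_eqF.
  have NH0 : 0 <= S ^+ 2 * (N1 * H / n%:R).
    by rewrite mulr_ge0 ?sqr_ge0 // divr_ge0 // mulr_ge0 // ltW.
  rewrite exprMn [leRHS](_ : _ = ((1 + C3) ^+ 2 * kap ^+ 2) * (S ^+ 2 * (N1 * H / n%:R))); last by ring.
  apply: ler_wpM2r => //; apply: ler_pM => //; try exact: ltW.
  by rewrite expr2 ler_peMl // ltW.
rewrite -/S -/H; set y := (X in Num.sqrt X) in target *.
rewrite -[(1 + C3) * S]ger0_norm; last by rewrite mulr_ge0 // ltW.
rewrite -sqrtr_sqr -sqrtrM ?sqr_ge0 //.
apply: ler_wsqrtr; exact: le_trans err target.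
Qed.
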